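(* Let $C$ be a coalgebra over a field $K$. The Gabriel quiver of $C$ coincides with the Ext quiver of $C$. That is, writing the coradical as $C_0=\bigoplus_{i\in I}D^i$ with $D^i$ simple subcoalgebras and letting $S_i$ be the simple right $C$-comodule corresponding to $D^i$, one has for all $i,j\in I$ $$\dim_K\bigl(e_i\cdot {}^j(C_1/C_0)^i\cdot e_j\bigr)=\dim_K \mathrm{Ext}^1(S_i,S_j),$$ where $\mathrm{Ext}^1$ is taken in the category of right $C$-comodules.
   Context: $K$ is a fixed field; all coalgebras and tensor products are over $K$. $C$ is an arbitrary coalgebra (not necessarily finite-dimensional) with comultiplication $\Delta$ and coradical filtration $\{C_n\}$; $C_0=\bigoplus_{i\in I}D^i$ with $D^i$ the simple subcoalgebras (each finite-dimensional). Bicomodule structure: let $\pi_0:C\to C/C_0$ be the projection. The maps $(\mathrm{Id}\otimes\pi_0)\circ\Delta$ and $(\pi_0\otimes \mathrm{Id})\circ\Delta$ vanish on $C_0$ and induce $\rho_l:C_1/C_0\to C_0\otimes C_1/C_0$ and $\rho_r:C_1/C_0\to C_1/C_0\otimes C_0$, making $C_1/C_0$ a $C_0$-$C_0$-bicomodule. For $i,j\in I$ put ${}^i(C_1/C_0)^j=\{m\in C_1/C_0 : \rho_l(m)\in D^i\otimes C_1/C_0,\ \rho_r(m)\in C_1/C_0\otimes D^j\}$. It is a $D^i$-$D^j$-bicomodule, hence a $(D^j)^*$-$(D^i)^*$-bimodule via $f\cdot m=\sum m_0f(m_1)$, $m\cdot g=\sum g(m_{-1})m_0$, where $\rho_r(m)=\sum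 m_0\otimes m_1$, $\rho_l(m)=\sum m_{-1}\otimes m_0$. Each $(D^i)^*\simeq M_{n_i}(\Delta_i)$ with $\Delta_i$ a finite-dimensional division $K$-algebra; fix a primitive idempotent $e_i\in (D^i)^*$. The Gabriel quiver $Q(C)$ has vertex set $I$ and $t_{ij}=\dim_K(e_i\cdot{}^j(C_1/C_0)^i\cdot e_j)$ arrows from $i$ to $j$ (independent of the choice of the $e_i$; $I$ and the $t_{ij}$ may be infinite). $\{S_i\mid i\in I\}$ is the complete set of isoclasses of simple right $C$-comodules, indexed so that $D^i\simeq n_iS_i$ (direct sum of $n_i$ copies) as right $C$-comodules. The Ext quiver of $C$ has vertex set $I$ and $\dim_K\mathrm{Ext}^1(S_i,S_j)$ arrows from $i$ to $j$. *)

(* Defs.v *)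
From HB Require Import structures.
From mathcomp Require Import all_boot all_algebra finmap.
From mathcomp Require Import boolp classical_sets functions cardinality.
From mathcomp.multinomials Require Import monalg.

Set Implicit Arguments.
Unset Strict Implicit.
Unset Printing Implicit Defensive.

Import GRing.Theory.
Local Open Scope ring_scope.

Section Subspaces.
Variables (K : fieldType) (V : lmodType K).

Definition sub (U : submodClosed V) := {x : V | x \in U}.
HB.instance Definition _ U := SubChoice.on (sub U).
HB.instance Definition _ U := [SubChoice_isSubLmodule of sub U by <:].

(* Subspaces are bundled predicates [submodClosed V]; [subspace_of] packs a
   Prop-valued predicate closed under the vector space operations. *)
Definition asPred (P : V -> Prop) : {pred V} := fun x => `[< P x >].

Definition subspace_of (P : V -> Prop)
    (clP : subsemimod_closed (asPred P)) : submodClosed V :=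
  HB.pack (asPred P) (GRing.isSubmodClosed.Build K V (asPred P) clP).

Lemma subspace_ofP P clP x : reflect (P x) (x \in @subspace_of P clP).
Proof. exact: asboolP. Qed.

Lemma closedPP (P : V -> Prop) : P 0 -> (forall x y, P x -> P y -> P (x + y)) ->
  (forall a x, P x -> P (a *: x)) -> subsemimod_closed (asPred P).
Proof.
move=> P0 PD PZ; split; first split.
- exact/asboolP.
- by move=> x y /asboolP Px /asboolP Py; apply/asboolP/PD.
- by move=> a x /asboolP Px; apply/asboolP/PZ.
Qed.

Fact span_closed (A : V -> Prop) : subsemimod_closed
  (asPred (fun x => forall U : submodClosed V, (forall y, A y -> y \in U) -> x \in U)).
Proof.
apply: closedPP => [U _|x y Px Py U AU|a x Px U AU]; first exact: rpred0.
  by apply: rpredD; [exact: Px|exact: Py].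
by apply: rpredZ; exact: Px.
Qed.
Definition span A := subspace_of (span_closed A).

Lemma span_in A x : A x -> x \in span A.
Proof. by move=> Ax; apply/subspace_ofP => U; apply. Qed.

Lemma span_sub A (U : submodClosed V) :
  (forall y, A y -> y \in U) -> {subset span A <= U}.
Proof. by move=> AU x /subspace_ofP; apply. Qed.

Fact full_closed : subsemimod_closed (asPred (fun _ => True)).
Proof. exact: closedPP. Qed.
Definition full := subspace_of full_closed.

Lemma in_full x : x \in full. Proof. exact/subspace_ofP. Qed.

Definition zpred (U : submodClosed V) : {pred V} := U.
Fact zpred_closed U : zmod_closed (zpred U).
Proof.
split=> [|x y Ux Uy]; first exact: (rpred0 U).
by rewrite -[- y]scaleN1r /zpred; apply: rpredD => //; apply: rpredZ.
Qed.
HB.instance Definition _ U :=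
  GRing.isZmodClosed.Build V (zpred U) (zpred_closed U).

Definition cosets (U : submodClosed V) := Quotient.quot (zpred U).
HB.instance Definition _ U := GRing.Zmodule.on (cosets U).

Section CosetsLmod.
Variable U : submodClosed V.

Let qproj (x : V) : cosets U := \pi_(Quotient.quot (zpred U))%qT x.
Let rep (x : cosets U) : V := repr x.
Let piK x : qproj (rep x) = x. Proof. exact: reprK. Qed.
Let pi_eq x y : (qproj x == qproj y) = (x - y \in U).
Proof. by rewrite /qproj -Quotient.idealrBE. Qed.
Let piB x y : qproj (x - y) = qproj x - qproj y. Proof. exact: raddfB. Qed.
Let pi0 : qproj 0 = 0. Proof. by rewrite -(subrr 0) piB subrr. Qed.
Let piD x y : qproj (x + y) = qproj x + qproj y.
Proof. by rewrite -[y]opprK piB -[- - y]sub0r piB pi0 sub0r. Qed.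

Definition coset_scale a (x : cosets U) := qproj (a *: rep x).
Let piZ a x : coset_scale a (qproj x) = qproj (a *: x).
Proof.
by apply/eqP; rewrite pi_eq -scalerBr; apply: rpredZ; rewrite -pi_eq piK.
Qed.

Fact coset_scaleA a b x :
  coset_scale a (coset_scale b x) = coset_scale (a * b) x.
Proof. by rewrite -[x]piK !piZ scalerA. Qed.
Fact coset_scale1 : left_id 1 coset_scale.
Proof. by move=> x; rewrite -[x]piK piZ scale1r. Qed.
Fact coset_scaleDr : right_distributive coset_scale +%R.
Proof. by move=> a x y; rewrite -[x]piK -[y]piK -piD !piZ scalerDr piD. Qed.
Fact coset_scaleDl x : {morph coset_scale^~ x : a b / a + b}.
Proof. by move=> a b; rewrite -[x]piK !piZ scalerDl piD. Qed.
HB.instance Definition _ := GRing.Zmodule_isLmodule.Build K (cosets U)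
  coset_scaleA coset_scale1 coset_scaleDr coset_scaleDl.

(* The quotient V / U.  Only this specification is used: [quotient_space] is
   opaque, so that unification never unfolds the construction by cosets. *)
Record quotient := Quotient {
  quo :> lmodType K;
  qpi : {linear V -> quo};
  qpi_surj : forall y, exists x, qpi x = y;
  qpi_eq0 : forall x, (qpi x == 0) = (x \in U) }.

Lemma quotient_space : quotient.
Proof.
have pi_lin : linear qproj by move=> a x y; rewrite piD -piZ.
apply: (@Quotient (cosets U)
  (HB.pack qproj (GRing.isLinear.Build K V (cosets U) *:%R qproj pi_lin))) => [y|x].
  by exists (rep y); exact: piK.
by rewrite -pi0 pi_eq subr0.
Qed.
End CosetsLmod.
End Subspaces.

Arguments full {K V}.
Notation "V ⧸ U" := (quo (@quotient_space _ V U)) (at level 40) : type_scope.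

Section QuoLift.
Variables (K : fieldType) (V W : lmodType K) (U : submodClosed V).
Definition qproj : {linear V -> (V ⧸ U)%type} := qpi (quotient_space U).
Lemma pi_surj y : exists x, qproj x = y. Proof. exact: qpi_surj. Qed.
Lemma pi_eq0 x : (qproj x == 0) = (x \in U). Proof. exact: qpi_eq0. Qed.

Variables (f : {linear V -> W}) (f0 : forall x, x \in U -> f x = 0).

Definition quo_lift of (forall x, x \in U -> f x = 0) :=
  fun x : (V ⧸ U)%type => f (projT1 (cid (pi_surj x))).

Lemma quo_liftE x : quo_lift f0 (qproj x) = f x.
Proof.
rewrite /quo_lift; case: cid => y /= yx; apply/eqP.
by rewrite -subr_eq0 -linearB; apply/eqP/f0; rewrite -pi_eq0 linearB /= yx subrr.
Qed.

Fact quo_lift_linear : linear (quo_lift f0).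
Proof.
move=> a x y; have [u <-] := pi_surj x; have [v <-] := pi_surj y.
by rewrite -linearP !quo_liftE linearP.
Qed.
HB.instance Definition _ :=
  GRing.isLinear.Build K (V ⧸ U)%type W *:%R (quo_lift f0) quo_lift_linear.
End QuoLift.
Arguments qproj {K V} U.

Section Kernel.
Variables (K : fieldType) (V W : lmodType K) (f : {linear V -> W}).
Fact kernel_closed : subsemimod_closed (asPred (fun x => f x = 0)).
Proof.
apply: closedPP => [|x y fx fy|a x fx]; first exact: raddf0.
  by rewrite linearD fx fy addr0.
by rewrite linearZ_LR fx scaler0.
Qed.
Definition ker := subspace_of kernel_closed.
Variable U : submodClosed V.
Fact image_closed : subsemimod_closed (asPred (fun y => exists2 x, x \in U & f x = y)).
Proof.
apply: closedPP => [|_ _ [x Ux <-] [y Uy <-]|a _ [x Ux <-]].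
- by exists 0; [exact: (rpred0 U)|exact: raddf0].
- by exists (x + y); [exact: rpredD|exact: raddfD].
- by exists (a *: x); [exact: rpredZ|exact: linearZ_LR].
Qed.
Definition image := subspace_of image_closed.
End Kernel.

Section FreeLift.
Variables (K : fieldType) (X : choiceType) (W : lmodType K) (h : X -> W).

Definition free_lift (g : {malg K[X]}) : W := \sum_(k <- msupp g) g@_k *: h k.

Lemma free_liftEw (d : {fset X}) g : (msupp g `<=` d)%fset ->
  free_lift g = \sum_(k <- d) g@_k *: h k.
Proof.
move=> le; rewrite /free_lift (big_fset_incl _ le) //= => k _ Nk.
by rewrite mcoeff_outdom ?scale0r.
Qed.

Fact free_lift_linear : linear free_lift.
Proof.
move=> a x y.
pose d := (msupp x `|` msupp y `|` msupp (a *: x + y))%fset.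
rewrite !(@free_liftEw d) ?/d; last 3 first.
- by apply/fsubsetP => k; rewrite !inE => ->; rewrite ?orbT.
- by apply/fsubsetP => k; rewrite !inE => ->; rewrite ?orbT.
- by apply/fsubsetP => k; rewrite !inE => ->; rewrite ?orbT.
rewrite scaler_sumr -big_split; apply: eq_bigr => k _ /=.
by rewrite mcoeffD mcoeffZ scalerDl scalerA.
Qed.
HB.instance Definition _ :=
  GRing.isLinear.Build K {malg K[X]} W *:%R free_lift free_lift_linear.

Lemma free_liftU k : free_lift << k >> = h k.
Proof. by rewrite /free_lift msuppU oner_eq0 big_seq_fset1 mcoeffUU scale1r. Qed.

Lemma malg_ind (P : {malg K[X]} -> Prop) : P 0 ->
  (forall a k x, P x -> P (a *: << k >> + x)) -> forall x, P x.
Proof.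
move=> P0 PD x; rewrite (monalgE x); elim: (enum_fset _) => [|k s IH].
  by rewrite big_nil.
rewrite big_cons; have -> : << x@_k *g k >> = x@_k *: << k >> :> {malg K[X]}.
  by apply/malgP => k'; rewrite mcoeffZ !mcoeffU mulr_natr.
exact: PD.
Qed.
End FreeLift.

Section Tensor.
Variables (K : fieldType) (V W : lmodType K).
Local Notation F := {malg K[(V * W)%type]}.
Local Notation "[[ v , w ]]" := (<< (v, w) >> : F).

Variant tensor_rel : F -> Prop :=
| TensorDl v1 v2 w : tensor_rel ([[v1 + v2, w]] - [[v1, w]] - [[v2, w]])
| TensorDr v w1 w2 : tensor_rel ([[v, w1 + w2]] - [[v, w1]] - [[v, w2]])
| TensorZl a v w : tensor_rel ([[a *: v, w]] - a *: [[v, w]])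
| TensorZr a v w : tensor_rel ([[v, a *: w]] - a *: [[v, w]]).

Let T := (F ⧸ span tensor_rel)%type.
Definition tens_model (v : V) (w : W) : T := qproj _ [[v, w]].
Let pi_rel x : tensor_rel x -> qproj (span tensor_rel) x = 0.
Proof. by move=> rx; apply/eqP; rewrite pi_eq0; apply: span_in. Qed.

Fact tens_model_bilinear : bilinear_for *:%R *:%R tens_model.
Proof.
split=> [w a x y|v a x y] /=; rewrite /tens_model.
  have /eqP := pi_rel (TensorDl (a *: x) y w).
  have /eqP := pi_rel (TensorZl a x w).
  rewrite !linearB /= !subr_eq0 linearZ_LR => /eqP <-.
  by rewrite subr_eq addrC => /eqP.
have /eqP := pi_rel (TensorDr v (a *: x) y).
have /eqP := pi_rel (TensorZr a v x).
rewrite !linearB /= !subr_eq0 linearZ_LR => /eqP <-.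
by rewrite subr_eq addrC => /eqP.
Qed.
HB.instance Definition _ := bilinear_isBilinear.Build K V W T *:%R *:%R
  tens_model tens_model_bilinear.

Fact tlift_rel (U : lmodType K) (b : {bilinear V -> W -> U}) x :
  x \in span tensor_rel -> free_lift (fun p => b p.1 p.2) x = 0.
Proof.
pose h := free_lift (fun p : V * W => b p.1 p.2).
move=> xin; have: x \in ker h; last by move/subspace_ofP.
apply: span_sub xin => y ry; apply/subspace_ofP.
case: ry => [v v' w|v w w'|a v w|a v w];
  rewrite !linearB ?linearZ_LR /= !free_liftU /=.
- by rewrite linearDl addrAC addrK subrr.
- by rewrite linearDr addrAC addrK subrr.
- by rewrite linearZl_LR scalerN subrr.
- by rewrite linearZr_LR scalerN subrr.
Qed.

(* The tensor product, by its universal property (uniqueness of [tlift] follows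
   from generation by pure tensors, [tensor_ind]).  [tensor_space] is the
   usual quotient of the free module on V * W, kept opaque. *)
Record tensor_product := TensorProduct {
  tensor :> lmodType K;
  tens : {bilinear V -> W -> tensor};
  tlift : forall U : lmodType K, {bilinear V -> W -> U} -> {linear tensor -> U};
  tliftE : forall (U : lmodType K) (b : {bilinear V -> W -> U}) v w, tlift b (tens v w) = b v w;
  tensor_ind : forall P : tensor -> Prop, P 0 ->
    (forall v w t, P t -> P (tens v w + t)) -> forall t, P t }.

Lemma tensor_space : tensor_product.
Proof.
apply: (@TensorProduct T tens_model (fun U b => quo_lift (tlift_rel b))).
  by move=> U b v w; exact: etrans (quo_liftE _ _) (free_liftU _ _).
move=> P P0 PD t; have [x <-] := pi_surj t; move: x; apply: malg_ind.
  by rewrite linear0.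
move=> a [v w] x Px; rewrite linearD /= linearZ_LR.
have -> : a *: qproj (span tensor_rel) [[v, w]] = tens_model (a *: v) w.
  by rewrite linearZl_LR.
exact: PD.
Qed.
End Tensor.

Notation "V ⊗ W" := (tensor (@tensor_space _ V W))
  (at level 40, left associativity) : type_scope.
Notation "v ⊗ w" := (tens (tensor_space _ _) v w)
  (at level 40, left associativity) : ring_scope.

Lemma tensor_eq (K : fieldType) (V W U : lmodType K)
  (f g : {linear (V ⊗ W)%type -> U}) :
  (forall v w, f (v ⊗ w) = g (v ⊗ w)) -> f =1 g.
Proof.
move=> fg; apply: tensor_ind => [|v w t fgt]; first by rewrite !linear0.
by rewrite !linearD /= fg fgt.
Qed.

Section TensorMaps.
Variable K : fieldType.

Section Tmap.
Variables (V V' W W' : lmodType K) (f : {linear V -> V'}) (g : {linear W -> W'}).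
Definition tmap_bil v w := f v ⊗ g w.
Fact tmap_bil_bilinear : bilinear_for *:%R *:%R tmap_bil.
Proof.
split=> [w a x y|v a x y]; rewrite /tmap_bil linearP.
  by rewrite linearPl.
by rewrite linearPr.
Qed.
HB.instance Definition _ := bilinear_isBilinear.Build K V W (V' ⊗ W')%type
  *:%R *:%R tmap_bil tmap_bil_bilinear.
Definition tmap : {linear (V ⊗ W)%type -> (V' ⊗ W')%type} := tlift (tensor_space _ _) tmap_bil.
Lemma tmapE v w : tmap (v ⊗ w) = f v ⊗ g w.
Proof. exact: tliftE. Qed.
End Tmap.

Section Tassoc.
Variables (U V W : lmodType K).
Definition tassoc_in (w : W) (u : U) (v : V) : (U ⊗ (V ⊗ W))%type := u ⊗ (v ⊗ w).
Fact tassoc_in_bilinear w : bilinear_for *:%R *:%R (tassoc_in w).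
Proof.
split=> [v a x y|u a x y]; rewrite /tassoc_in; first by rewrite linearPl.
by rewrite linearPl linearPr.
Qed.
HB.instance Definition _ w := bilinear_isBilinear.Build K U V
  (U ⊗ (V ⊗ W))%type *:%R *:%R (tassoc_in w) (tassoc_in_bilinear w).
Definition tassoc_out (t : (U ⊗ V)%type) (w : W) := tlift (tensor_space U V) (tassoc_in w) t.
Fact tassoc_out_bilinear : bilinear_for *:%R *:%R tassoc_out.
Proof.
split=> [w a x y|t a x y]; rewrite /tassoc_out; first by rewrite linearP.
move: t; apply: tensor_ind => [|u v t IH].
  by rewrite !linear0 /= scaler0 addr0.
rewrite !linearD /= IH !tliftE /= /tassoc_in linearPr linearPr /=.
by rewrite scalerDr addrACA.
Qed.
HB.instance Definition _ := bilinear_isBilinear.Build K (U ⊗ V)%type W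
  (U ⊗ (V ⊗ W))%type *:%R *:%R tassoc_out tassoc_out_bilinear.
Definition tassoc : {linear ((U ⊗ V) ⊗ W)%type -> (U ⊗ (V ⊗ W))%type} :=
  tlift (tensor_space _ _) tassoc_out.
Lemma tassocE u v w : tassoc (u ⊗ v ⊗ w) = u ⊗ (v ⊗ w).
Proof. rewrite /tassoc tliftE /=; exact: tliftE. Qed.
End Tassoc.
End TensorMaps.
Arguments tassoc {K U V W}.

Section Complement.
Variables (K : fieldType) (V : lmodType K) (U : submodClosed V).

Fact sub0_closed : subsemimod_closed (asPred (fun x : V => x = 0)).
Proof.
by apply: closedPP => [|x y -> ->|a x ->]; rewrite ?addr0 ?scaler0.
Qed.
Fact add_closed (A B : submodClosed V) : subsemimod_closed
  (asPred (fun x : V => exists a b, [/\ a \in A, b \in B & x = a + b])).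
Proof.
apply: closedPP => [|x y [a [b [Aa Bb ->]]] [c [d [Ac Bd ->]]]|k x [a [b [Aa Bb ->]]]].
- by exists 0, 0; rewrite addr0; split=> //; [exact: (rpred0 A)|exact: (rpred0 B)].
- by exists (a + c), (b + d); rewrite addrACA; split=> //; exact: rpredD.
- by exists (k *: a), (k *: b); rewrite scalerDr; split=> //; exact: rpredZ.
Qed.

Let compl := {W : submodClosed V | forall x, x \in U -> x \in W -> x = 0}.
Let incl (A B : compl) := `[< {subset sval A <= sval B} >].

Lemma complement_exists : exists W : submodClosed V,
  (forall x, x \in U -> x \in W -> x = 0) /\
  forall x, exists u w, [/\ u \in U, w \in W & x = u + w].
Proof.
have t0 : compl by exists (subspace_of sub0_closed) => x _ /subspace_ofP.
have [||A totA|[W UW] maxW] := @ZL_preorder compl t0 incl.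
- by move=> A; apply/asboolP.
- by move=> A B C /asboolP AB /asboolP BC; apply/asboolP => x /AB /BC.
- have clA : subsemimod_closed
    (asPred (fun x : V => x = 0 \/ exists2 B : compl, A B & x \in sval B)).
    apply: closedPP => [|x y|a x]; first by left.
      move=> [->|[B AB xB]] [->|[C AC yC]].
      - by left; rewrite addr0.
      - by right; exists C; rewrite ?add0r.
      - by right; exists B; rewrite ?addr0.
      case: (totA B C AB AC) => /asboolP BC; right.
        by exists C => //; apply: rpredD => //; exact: BC.
      by exists B => //; apply: rpredD => //; exact: BC.
    move=> [->|[B AB xB]]; first by left; rewrite scaler0.
    by right; exists B => //; exact: rpredZ.
  have UA x : x \in U -> x \in subspace_of clA -> x = 0.
    by move=> Ux /subspace_ofP[//|[B AB xB]]; exact: (svalP B).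
  exists (exist _ _ UA) => B AB; apply/asboolP => x xB.
  by apply/subspace_ofP; right; exists B.
exists W; split=> // v; apply: contrapT => Nv.
pose L := span (fun x => x = v).
pose W' := subspace_of (add_closed W L).
have Lv x : x \in L -> exists a, x = a *: v.
  have cl : subsemimod_closed (asPred (fun x : V => exists a, x = a *: v)).
    apply: closedPP => [|_ _ [a ->] [b ->]|b _ [a ->]].
    - by exists 0; rewrite scale0r.
    - by exists (a + b); rewrite scalerDl.
    - by exists (b * a); rewrite scalerA.
  move=> xL; have: x \in subspace_of cl; last by move/subspace_ofP.
  by apply: span_sub xL => _ ->; apply/subspace_ofP; exists 1; rewrite scale1r.
have UW' x : x \in U -> x \in W' -> x = 0.
  move=> Ux /subspace_ofP[w [_ [Ww /Lv[a ->] ex]]].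
  have [a0|a0] := eqVneq a 0.
    by apply: (UW) => //; rewrite ex a0 scale0r addr0.
  case: Nv; exists (a^-1 *: x), (- a^-1 *: w); split; [exact: rpredZ|exact: rpredZ|].
  by rewrite scaleNr ex -scalerBr addrAC subrr add0r scalerA mulVf ?scale1r.
have WW' : incl (exist _ W UW) (exist _ W' UW').
  apply/asboolP => x /= Wx; apply/(subspace_ofP (add_closed W L)). exists x, 0.
  by rewrite addr0; split=> //; exact: (rpred0 L).
move: (maxW _ WW') => /asboolP /= /(_ v) vW; apply: Nv; exists 0, v.
rewrite add0r; split=> //; [exact: (rpred0 U)|apply: vW; apply/(subspace_ofP (add_closed W L))].
by exists 0, v; rewrite add0r; split=> //; [exact: (rpred0 W)|exact: span_in].
Qed.

Lemma retraction_exists :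
  exists r : {linear V -> sub U}, forall u, r (val u) = u.
Proof.
have [W [UW VUW]] := complement_exists.
have /choice[r rP] x : exists u : sub U, x - val u \in W.
  have [u [w [Uu Ww ->]]] := VUW x; exists (exist _ u Uu) => /=.
  by rewrite addrAC subrr add0r.
have rU x u : x - val u \in W -> r x = u.
  move=> xu; apply/val_inj/eqP; rewrite -subr_eq0; apply/eqP; apply: (UW).
    by rewrite -raddfB; exact: valP.
  rewrite -(subrK x (val (r x))) -addrA.
  by apply: rpredD => //; rewrite -opprB -scaleN1r; apply: rpredZ.
have rL : linear r.
  move=> a x y; apply: rU.
  rewrite (linearP (\val : {linear sub U -> V})) /= opprD addrACA -scalerBr.
  by apply: rpredD => //; exact: rpredZ.
pose rl : {linear V -> sub U} := HB.pack r (GRing.isLinear.Build K V (sub U) *:%R r rL).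
exists rl => u /=.
by apply: rU; rewrite subrr; exact: (rpred0 W).
Qed.

(* A K-linear retraction onto U.  It is a choice, but below it is only applied to
   tensor factors known to lie in U, where it is the identity. *)
Definition retr : {linear V -> sub U} := projT1 (cid retraction_exists).
Lemma retrK u : retr (val u) = u.
Proof. exact: (projT2 (cid retraction_exists)). Qed.
End Complement.

Section SubspaceOps.
Variables (K : fieldType) (V W : lmodType K).

Definition addsp (A B : submodClosed V) := subspace_of (add_closed A B).

Fact preim_closed (f : {linear V -> W}) (U : submodClosed W) :
  subsemimod_closed (asPred (fun x => f x \in U)).
Proof.
apply: closedPP => [|x y fx fy|a x fx].
- by rewrite linear0; exact: (rpred0 U).
- by rewrite linearD; exact: rpredD.
- by rewrite linearZ_LR; exact: rpredZ.
Qed.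
Definition preim f U := subspace_of (preim_closed f U).

(* A (x) B as a subspace of V (x) W; over a field the canonical map from the tensor
   product of A and B onto it is bijective, see [tsub_retr] and [tsub_val]. *)
Definition tsub (A : submodClosed V) (B : submodClosed W) :
    submodClosed (V ⊗ W)%type :=
  span (fun t => exists a b, [/\ a \in A, b \in B & t = a ⊗ b]).

Lemma tsub_in (A : submodClosed V) (B : submodClosed W) a b :
  a \in A -> b \in B -> a ⊗ b \in tsub A B.
Proof. by move=> Aa Bb; apply: span_in; exists a, b. Qed.
End SubspaceOps.

Section TensorFunctoriality.
Variable K : fieldType.

Lemma tmap_comp (V1 V2 V3 W1 W2 W3 : lmodType K)
    (f : {linear V1 -> V2}) (f' : {linear V2 -> V3})
    (g : {linear W1 -> W2}) (g' : {linear W2 -> W3}) t :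
  tmap f' g' (tmap f g t) = tmap (f' \o f) (g' \o g) t.
Proof.
by move: t; apply: (tensor_eq (f := tmap f' g' \o tmap f g)) => v w;
  rewrite /= !tmapE.
Qed.

Lemma tmap_ext (V V' W W' : lmodType K) (f f' : {linear V -> V'})
    (g g' : {linear W -> W'}) : f =1 f' -> g =1 g' -> tmap f g =1 tmap f' g'.
Proof. by move=> ff gg; apply: tensor_eq => v w; rewrite !tmapE ff gg. Qed.

Lemma tmap_id (V W : lmodType K) (f : {linear V -> V}) (g : {linear W -> W}) :
  f =1 id -> g =1 id -> tmap f g =1 id.
Proof.
move=> ff gg; apply: (tensor_eq (g := idfun)) => v w.
by rewrite tmapE ff gg.
Qed.

Lemma tsub_val (V W : lmodType K) (A : submodClosed V) (B : submodClosed W)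
    (t : (sub A ⊗ sub B)%type) :
  tmap (retr A) (retr B) (tmap \val \val t) = t.
Proof. by rewrite tmap_comp; apply: tmap_id => x /=; rewrite retrK. Qed.

Lemma tsub_retr (V W : lmodType K) (A : submodClosed V) (B : submodClosed W) t :
  t \in tsub A B -> tmap \val \val (tmap (retr A) (retr B) t) = t.
Proof.
pose f := tmap \val \val \o tmap (retr A) (retr B) \- idfun.
move=> tAB; have: t \in ker f; last by move/subspace_ofP/eqP; rewrite subr_eq0 => /eqP.
apply: span_sub tAB => _ [a [b [Aa Bb ->]]]; apply/subspace_ofP.
rewrite /f /= !tmapE -[a]/(val (exist (fun x => x \in A) a Aa)).
by rewrite -[b]/(val (exist (fun x => x \in B) b Bb)) !retrK subrr.
Qed.

Lemma tmap_sub (V V' W W' : lmodType K) (f : {linear V -> V'})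
    (g : {linear W -> W'}) (A : submodClosed V) (B : submodClosed W)
    (A' : submodClosed V') (B' : submodClosed W') t :
  (forall a, a \in A -> f a \in A') -> (forall b, b \in B -> g b \in B') ->
  t \in tsub A B -> tmap f g t \in tsub A' B'.
Proof.
move=> fA gB tAB.
have: t \in preim (tmap f g) (tsub A' B'); last by move/subspace_ofP.
apply: span_sub tAB => _ [a [b [Aa Bb ->]]]; apply/subspace_ofP.
by rewrite tmapE; apply: tsub_in; [exact: fA|exact: gB].
Qed.

Lemma tmapDl (V V' W W' : lmodType K) (f g h : {linear V -> V'})
    (k : {linear W -> W'}) a t : (forall v, h v = a *: f v + g v) ->
  tmap h k t = a *: tmap f k t + tmap g k t.
Proof.
move=> hE; move: t.
apply: (tensor_eq (g := (a \*: tmap f k) \+ tmap g k)) => v w.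
by rewrite /= !tmapE hE linearDl linearZl_LR.
Qed.

Lemma tmap0l (V V' W W' : lmodType K) (k : {linear W -> W'}) t :
  tmap (\0 : {linear V -> V'}) k t = 0.
Proof.
rewrite (@tmapDl _ _ _ _ \0 \0 _ _ (-1)) ?scaleN1r ?addNr // => v /=.
by rewrite scaler0 addr0.
Qed.

Lemma tassoc_nat (U V W U' V' W' : lmodType K) (f : {linear U -> U'})
    (g : {linear V -> V'}) (h : {linear W -> W'}) t :
  tassoc (tmap (tmap f g) h t) = tmap f (tmap g h) (tassoc t).
Proof.
move: t; apply: (tensor_eq (f := tassoc \o tmap (tmap f g) h)
  (g := tmap f (tmap g h) \o tassoc)) => x w /=; move: x.
have Lw (x : (U ⊗ V)%type) : tassoc (tmap (tmap f g) h (x ⊗ w)) =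
   (tassoc \o (applyr (tens (tensor_space _ _)) (h w) \o tmap f g)) x.
  by rewrite tmapE.
apply: tensor_ind => [|u v x IH]; first by rewrite linear0l !linear0.
by rewrite linearDl !linearD /= IH !(tmapE, tassocE).
Qed.

Section Tunassoc.
Variables U V W : lmodType K.
Definition tunassoc_bil (u : U) (t : (V ⊗ W)%type) : ((U ⊗ V) ⊗ W)%type :=
  tmap (tens (tensor_space U V) u) idfun t.
Fact tunassoc_bilinear : bilinear_for *:%R *:%R tunassoc_bil.
Proof.
split=> [t a x y|u a x y]; rewrite /tunassoc_bil; last by rewrite linearP.
by apply: tmapDl => v /=; rewrite linearDl linearZl_LR.
Qed.
HB.instance Definition _ := bilinear_isBilinear.Build K U (V ⊗ W)%type
  ((U ⊗ V) ⊗ W)%type *:%R *:%R tunassoc_bil tunassoc_bilinear.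
Definition tunassoc : {linear (U ⊗ (V ⊗ W))%type -> ((U ⊗ V) ⊗ W)%type} :=
  tlift (tensor_space _ _) tunassoc_bil.
Lemma tunassocE u t : tunassoc (u ⊗ t) = tmap (tens (tensor_space U V) u) idfun t.
Proof. exact: tliftE. Qed.

Lemma tassocK t : tunassoc (tassoc t) = t.
Proof.
move: t; apply: (tensor_eq (f := tunassoc \o tassoc) (g := idfun)) => x w /=.
move: x; apply: tensor_ind => [|u v x IH]; first by rewrite linear0l !linear0.
by rewrite linearDl !linearD /= IH !(tassocE, tunassocE, tmapE).
Qed.
Lemma tunassocK t : tassoc (tunassoc t) = t.
Proof.
move: t; apply: (tensor_eq (f := tassoc \o tunassoc) (g := idfun)) => u x /=.
move: x; apply: tensor_ind => [|v w x IH]; first by rewrite linear0r !linear0.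
by rewrite linearDr !linearD /= IH tunassocE tmapE tassocE.
Qed.
End Tunassoc.

(* [contractl f] and [contractr f] are f (x) Id and Id (x) f followed by the
   identifications of K (x) W with W and of V (x) K with V. *)
Section Contract.
Variables V W : lmodType K.
Definition contractl_bil (f : {scalar V}) (v : V) (w : W) := f v *: w.
Fact contractl_bilinear f : bilinear_for *:%R *:%R (contractl_bil f).
Proof.
split=> [w a x y|v a x y]; rewrite /contractl_bil /=.
  by rewrite scalarP scalerDl scalerA.
by rewrite scalerDr !scalerA mulrC.
Qed.
HB.instance Definition _ f := bilinear_isBilinear.Build K V W W *:%R *:%R
  (contractl_bil f) (contractl_bilinear f).
Definition contractl f : {linear (V ⊗ W)%type -> W} :=
  tlift (tensor_space V W) (contractl_bil f).
Lemma contractlE f v w : contractl f (v ⊗ w) = f v *: w.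
Proof. exact: tliftE. Qed.

Definition contractr_bil (f : {scalar W}) (v : V) (w : W) := f w *: v.
Fact contractr_bilinear f : bilinear_for *:%R *:%R (contractr_bil f).
Proof.
split=> [w a x y|v a x y]; rewrite /contractr_bil /=.
  by rewrite scalerDr !scalerA mulrC.
by rewrite scalarP scalerDl scalerA.
Qed.
HB.instance Definition _ f := bilinear_isBilinear.Build K V W V *:%R *:%R
  (contractr_bil f) (contractr_bilinear f).
Definition contractr f : {linear (V ⊗ W)%type -> V} :=
  tlift (tensor_space V W) (contractr_bil f).
Lemma contractrE f v w : contractr f (v ⊗ w) = f w *: v.
Proof. exact: tliftE. Qed.
End Contract.
End TensorFunctoriality.
Arguments contractl {K V W} f.
Arguments contractr {K V W} f.
Arguments tunassoc {K U V W}.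

Lemma contractr_nat (K : fieldType) (V V' W : lmodType K) (f : {linear V -> V'})
    (g : {scalar W}) t : contractr g (tmap f idfun t) = f (contractr g t).
Proof.
move: t; apply: (tensor_eq (f := contractr g \o tmap f idfun)
  (g := f \o contractr g)) => v w /=.
by rewrite tmapE !contractrE linearZ_LR.
Qed.

Section Basis.
Variables (K : fieldType) (V : lmodType K).

Definition free_family (B : set V) :=
  forall (s : seq V) (a : V -> K), uniq s -> (forall x, x \in s -> B x) ->
    \sum_(x <- s) a x *: x = 0 -> forall x, x \in s -> a x = 0.

Definition spanning (B : set V) :=
  forall v, exists (s : seq V) (a : V -> K),
    (forall x, x \in s -> B x) /\ v = \sum_(x <- s) a x *: x.

Definition is_basis B := free_family B /\ spanning B.
End Basis.

(* Equality of dimensions as cardinals, finite or infinite. *)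
Definition same_dim (K : fieldType) (V W : lmodType K) :=
  exists (B : set V) (B' : set W), [/\ is_basis B, is_basis B' & (B #= B')%card].

Record coalgebra (K : fieldType) := Coalgebra {
  coalg :> lmodType K;
  Delta : {linear coalg -> (coalg ⊗ coalg)%type};
  counit : {scalar coalg};
  Delta_coassoc : forall c,
    tassoc (tmap Delta idfun (Delta c)) = tmap idfun Delta (Delta c);
  Delta_counitl : forall c, contractl counit (Delta c) = c;
  Delta_counitr : forall c, contractr counit (Delta c) = c }.
Arguments Delta {K C} : rename.
Arguments counit {K C} : rename.

Section Coradical.
Variables (K : fieldType) (C : coalgebra K).

Definition subcoalgebra (D : submodClosed C) :=
  forall c, c \in D -> Delta c \in tsub D D.

Definition simple_subcoalgebra (D : submodClosed C) :=
  [/\ subcoalgebra D, exists2 c, c \in D & c != 0 &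
    forall E : submodClosed C, subcoalgebra E -> {subset E <= D} ->
      (exists2 c, c \in E & c != 0) -> {subset D <= E}].

Definition coradical : submodClosed C :=
  span (fun c => exists2 D, simple_subcoalgebra D & c \in D).

Fixpoint corad_filt (n : nat) : submodClosed C :=
  if n is m.+1 then
    preim Delta (addsp (tsub full (corad_filt m)) (tsub coradical full))
  else coradical.

Lemma subcoalgebra_coradical : subcoalgebra coradical.
Proof.
move=> c cC; have: c \in preim Delta (tsub coradical coradical); last first.
  by move/subspace_ofP.
apply: span_sub cC => x [D simD xD]; apply/subspace_ofP.
have [subD _ _] := simD.
rewrite -[Delta x](@tmap_id _ _ _ idfun idfun) //.
by apply: tmap_sub (subD _ xD) => y yD; apply: span_in; exists D.
Qed.

Let C0 := coradical.
Let Q : lmodType K := (C ⧸ C0)%type.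

Lemma tmap_kill (V1 V2 W1 W2 : lmodType K) (f : {linear V1 -> V2})
  (g : {linear W1 -> W2}) (A : submodClosed V1) (B : submodClosed W1) t :
  (forall a b, a \in A -> b \in B -> f a ⊗ g b = 0) ->
  t \in tsub A B -> tmap f g t = 0.
Proof.
move=> fg tAB; have: t \in ker (tmap f g); last by move/subspace_ofP.
apply: span_sub tAB => _ [a [b [Aa Bb ->]]]; apply/subspace_ofP.
by rewrite tmapE; exact: fg.
Qed.

Lemma coradical_pi c : c \in C0 -> qproj C0 c = 0.
Proof. by move=> cC; apply/eqP; rewrite pi_eq0. Qed.

(* (Id (x) pi_0) Delta and (pi_0 (x) Id) Delta.  They induce [rho_l] and [rho_r] on
   the whole of C / C_0; C_1 / C_0 is the subspace [C1C0] of C / C_0, and the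
   coactions of the bicomodule C_1 / C_0 are the restrictions. *)
Definition Delta_pi : {linear C -> (C ⊗ Q)%type} := tmap idfun (qproj C0) \o Delta.
Definition pi_Delta : {linear C -> (Q ⊗ C)%type} := tmap (qproj C0) idfun \o Delta.

Fact Delta_pi0 c : c \in C0 -> Delta_pi c = 0.
Proof.
move=> /subcoalgebra_coradical; apply: tmap_kill => a b _ /coradical_pi -> /=.
by rewrite linear0r.
Qed.
Fact pi_Delta0 c : c \in C0 -> pi_Delta c = 0.
Proof.
move=> /subcoalgebra_coradical; apply: tmap_kill => a b /coradical_pi -> _ /=.
by rewrite linear0l.
Qed.

Definition rho_l : {linear Q -> (C ⊗ Q)%type} := quo_lift Delta_pi0.
Definition rho_r : {linear Q -> (Q ⊗ C)%type} := quo_lift pi_Delta0.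

Definition C1C0 : submodClosed Q := image (qproj C0) (corad_filt 1).

(* [bipart D^i D^j] is ^i(C_1/C_0)^j. *)
Definition bipart_pred (D E : submodClosed C) (m : Q) :=
  [/\ m \in C1C0, rho_l m \in tsub D C1C0 & rho_r m \in tsub C1C0 E].
Fact bipart_closed D E : subsemimod_closed (asPred (bipart_pred D E)).
Proof.
apply: closedPP => [|x y [x1 x2 x3] [y1 y2 y3]|a x [x1 x2 x3]].
- by split; rewrite ?linear0; apply: rpred0.
- by split; rewrite ?linearD; apply: rpredD.
- by split; rewrite ?linearZ_LR; apply: rpredZ.
Qed.
Definition bipart D E := subspace_of (bipart_closed D E).

Section DualAlgebra.
Variable D : submodClosed C.

(* The comultiplication of D; see [DeltaD_val]. *)
Definition DeltaD : {linear sub D -> (sub D ⊗ sub D)%type} :=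
  tmap (retr D) (retr D) \o Delta \o \val.

(* (f * g)(c) = sum f(c_1) g(c_2), the product of the algebra D^*. *)
Definition conv (f g : {scalar sub D}) (c : sub D) : K :=
  f (contractr g (DeltaD c)).

Lemma DeltaD_val c : subcoalgebra D -> tmap \val \val (DeltaD c) = Delta (val c).
Proof. by move=> subD; apply: tsub_retr; apply: subD; exact: valP. Qed.

Definition idempotent_form (f : {scalar sub D}) := conv f f =1 f.

Definition primitive_idempotent (e : {scalar sub D}) :=
  [/\ idempotent_form e, exists c, e c != 0 &
    forall f g : {scalar sub D}, idempotent_form f -> idempotent_form g ->
      (forall c, conv f g c = 0) -> (forall c, conv g f c = 0) ->
      (forall c, e c = f c + g c) ->
      (forall c, f c = 0) \/ (forall c, g c = 0)].

(* f . m = sum m_0 f(m_1) and m . g = sum g(m_{-1}) m_0, for m such that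
   rho_r m (resp. rho_l m) has its C-factor in D; see [act_lE] and [act_rE]. *)
Definition act_l (f : {scalar sub D}) : {linear Q -> Q} :=
  contractr f \o tmap idfun (retr D) \o rho_r.
Definition act_r (f : {scalar sub D}) : {linear Q -> Q} :=
  contractl f \o tmap (retr D) idfun \o rho_l.

Lemma act_lE f m (t : (Q ⊗ sub D)%type) :
  tmap idfun \val t = rho_r m -> act_l f m = contractr f t.
Proof.
move=> tm.
have -> : act_l f m = contractr f (tmap idfun (retr D) (rho_r m)) by [].
rewrite -tm tmap_comp tmap_id // => x /=.
by rewrite retrK.
Qed.
Lemma act_rE f m (t : (sub D ⊗ Q)%type) :
  tmap \val idfun t = rho_l m -> act_r f m = contractl f t.
Proof.
move=> tm.
have -> : act_r f m = contractl f (tmap (retr D) idfun (rho_l m)) by [].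
rewrite -tm tmap_comp tmap_id // => x /=.
by rewrite retrK.
Qed.
End DualAlgebra.

(* e_i . ^j(C_1/C_0)^i . e_j *)
Definition gabriel_space (Di Dj : submodClosed C)
    (ei : {scalar sub Di}) (ej : {scalar sub Dj}) : submodClosed Q :=
  image (act_r ej \o act_l ei) (bipart Dj Di).
End Coradical.

Section Comodules.
Variables (K : fieldType) (C : coalgebra K).

Record comodule := Comodule {
  comod :> lmodType K;
  coact : {linear comod -> (comod ⊗ C)%type};
  coact_coassoc : forall m,
    tassoc (tmap coact idfun (coact m)) = tmap idfun Delta (coact m);
  coact_counit : forall m, contractr counit (coact m) = m }.
Arguments coact {M} : rename.

Definition regular : comodule :=
  @Comodule C Delta (@Delta_coassoc _ C) (@Delta_counitr _ C).

Definition colinear (M N : comodule) (f : {linear M -> N}) :=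
  forall m, coact (f m) = tmap f idfun (coact m).

Definition subcomodule (M : comodule) (N : submodClosed M) :=
  forall m, m \in N -> coact m \in tsub N full.

Definition simple_comodule (M : comodule) :=
  (exists m : M, m != 0) /\
  forall N : submodClosed M, subcomodule N ->
    (exists2 m, m \in N & m != 0) -> forall m, m \in N.

Definition comod_iso (M N : comodule) :=
  exists f : {linear M -> N}, colinear f /\ bijective f.

Section CoactImage.
Variables (M : comodule) (P : lmodType K) (pc : {linear P -> (P ⊗ C)%type}).
Variables (f : {linear M -> P}) (fE : forall m, pc (f m) = tmap f idfun (coact m)).

Lemma coassoc_image m :
  tassoc (tmap pc idfun (pc (f m))) = tmap idfun Delta (pc (f m)).
Proof.
rewrite fE tmap_comp.
have -> : tmap (pc \o f) (idfun \o idfun) (coact m) =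
    tmap (tmap f idfun) idfun (tmap coact idfun (coact m)).
  by rewrite tmap_comp; apply: tmap_ext.
rewrite tassoc_nat coact_coassoc !tmap_comp; apply: tmap_ext => // c /=.
by rewrite tmap_id.
Qed.

Lemma counit_image m : contractr counit (pc (f m)) = f m.
Proof. by rewrite fE contractr_nat coact_counit. Qed.
End CoactImage.

Section Power.
Variables (n : nat) (M : comodule).
Local Notation P := {ffun 'I_n -> M}.

Definition pow_in (k : 'I_n) (m : M) : P := [ffun l => if l == k then m else 0].
Fact pow_in_linear k : linear (pow_in k).
Proof.
move=> a x y; apply/ffunP => l; rewrite !ffunE /=.
by case: eqP => _; rewrite ?scaler0 ?addr0.
Qed.
HB.instance Definition _ k :=
  GRing.isLinear.Build K M P *:%R (pow_in k) (pow_in_linear k).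

Definition pow_coact (x : P) : (P ⊗ C)%type :=
  \sum_k tmap (pow_in k) idfun (coact (x k)).
Fact pow_coact_linear : linear pow_coact.
Proof.
move=> a x y; rewrite /pow_coact scaler_sumr -big_split; apply: eq_bigr => k _ /=.
by rewrite !ffunE !linearP.
Qed.
HB.instance Definition _ :=
  GRing.isLinear.Build K P (P ⊗ C)%type *:%R pow_coact pow_coact_linear.

Lemma pow_coact_in k m : pow_coact (pow_in k m) = tmap (pow_in k) idfun (coact m).
Proof.
rewrite /pow_coact (bigD1 k) //= big1 ?addr0 => [|l /negPf lk].
  by rewrite ffunE eqxx.
by rewrite ffunE lk !linear0.
Qed.

Lemma pow_sum (x : P) : x = \sum_k pow_in k (x k).
Proof.
apply/ffunP => l; rewrite sum_ffunE (bigD1 l) //= big1 ?addr0 => [|k /negPf kl].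
  by rewrite ffunE eqxx.
by rewrite ffunE eq_sym kl.
Qed.

Fact pow_coassoc (x : P) :
  tassoc (tmap pow_coact idfun (pow_coact x)) = tmap idfun Delta (pow_coact x).
Proof.
rewrite {2 3}/pow_coact !linear_sum /=; apply: eq_bigr => k _.
rewrite -!pow_coact_in; exact: (coassoc_image (pow_coact_in k)).
Qed.
Fact pow_counit (x : P) : contractr counit (pow_coact x) = x.
Proof.
rewrite /pow_coact [RHS]pow_sum linear_sum /=; apply: eq_bigr => k _.
rewrite -pow_coact_in; exact: (counit_image (pow_coact_in k)).
Qed.
Definition comod_pow : comodule :=
  @Comodule P pow_coact pow_coassoc pow_counit.
End Power.

Section Hom.
Variables M N : comodule.
Fact HomC_closed : subsemimod_closed
  (asPred (fun f : M -> N => exists2 g : {linear M -> N}, colinear g & f = g)).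
Proof.
apply: closedPP => [|_ _ [f fC ->] [g gC ->]|a _ [f fC ->]].
- by exists \0 => //= m; rewrite linear0 tmap0l.
- exists (f \+ g) => //= m; rewrite linearD fC gC.
  by rewrite (@tmapDl _ _ _ _ _ f g (f \+ g) _ 1) => [|v] /=; rewrite scale1r.
- exists (a \*: f) => //= m; rewrite linearZ_LR fC.
  rewrite (@tmapDl _ _ _ _ _ f \0 (a \*: f) _ a) ?tmap0l ?addr0 // => v /=.
  by rewrite addr0.
Qed.
(* The space of comodule maps, inside the space of all functions M -> N. *)
Definition HomC : submodClosed (M -> N) := subspace_of HomC_closed.
End Hom.
End Comodules.
Arguments coact {K C M} : rename.

Section Ext.
Variables (K : fieldType) (C : coalgebra K).
Local Notation comodule := (comodule C).

Definition injective_comodule (E : comodule) :=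
  forall (M N : comodule) (f : {linear M -> N}) (g : {linear M -> E}),
    colinear f -> injective f -> colinear g ->
    exists2 h : {linear N -> E}, colinear h & h \o f =1 g.

Record injective_resolution (N : comodule) := InjectiveResolution {
  res : nat -> comodule;
  res_aug : {linear N -> res 0};
  res_d : forall n, {linear res n -> res n.+1};
  res_inj : forall n, injective_comodule (res n);
  res_aug_colinear : colinear res_aug;
  res_d_colinear : forall n, colinear (res_d n);
  res_aug_inj : injective res_aug;
  res_exact0 : forall x, res_d 0 x = 0 <-> exists y, res_aug y = x;
  res_exact : forall n x, res_d n.+1 x = 0 <-> exists y, res_d n y = x }.

Section Ext1.
Variables (M N : comodule) (R : injective_resolution N).

Fact cocycle_closed : subsemimod_closed (asPred (fun f : M -> res R 1 =>
  f \in HomC M (res R 1) /\ forall m, res_d R 1 (f m) = 0)).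
Proof.
apply: closedPP => [|f g [fC f0] [gC g0]|a f [fC f0]].
- by split=> [|m]; [exact: (rpred0 (HomC _ _))|exact: linear0].
- by split=> [|m]; [exact: rpredD|rewrite linearD f0 g0 addr0].
- by split=> [|m]; [exact: rpredZ|rewrite linearZ_LR f0 scaler0].
Qed.
Definition cocycles := subspace_of cocycle_closed.

Fact coboundary_closed : subsemimod_closed (asPred (fun f : sub cocycles =>
  exists2 g : M -> res R 0, g \in HomC M (res R 0) & val f = res_d R 0 \o g)).
Proof.
apply: closedPP => [|f f' [g gC fg] [g' gC' fg']|a f [g gC fg]].
- exists 0; first exact: (rpred0 (HomC _ _)).
  by apply/funext => m /=; rewrite linear0.
- exists (g + g'); first exact: rpredD.
  by apply/funext => m; rewrite raddfD /= fg fg' /= linearD.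
- exists (a *: g); first exact: rpredZ.
  by apply/funext => m; rewrite linearZ_LR /= fg /= linearZ_LR.
Qed.
Definition coboundaries := subspace_of coboundary_closed.

(* H^1 of Hom_C(M, res R): the first right derived functor of Hom_C(M, -)
   evaluated at N, computed by the injective resolution R of N. *)
Definition Ext1 : lmodType K := (sub cocycles ⧸ coboundaries)%type.
End Ext1.

Section Cofree.
Variable V : lmodType K.
Local Notation VC := (V ⊗ C)%type.

Definition cof : {linear VC -> (VC ⊗ C)%type} := tunassoc \o tmap idfun Delta.

Lemma cofE v c : cof (v ⊗ c) = tmap (tens (tensor_space V C) v) idfun (Delta c).
Proof. by rewrite /= tmapE tunassocE. Qed.

Fact cof_coassoc t : tassoc (tmap cof idfun (cof t)) = tmap idfun Delta (cof t).
Proof.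
move: t; apply: (tensor_eq (f := tassoc \o tmap cof idfun \o cof)
   (g := tmap idfun Delta \o cof)) => v c.
exact: (coassoc_image (M := regular C) (cofE v)).
Qed.
Fact cof_counit t : contractr counit (cof t) = t.
Proof.
move: t; apply: (tensor_eq (f := contractr counit \o cof) (g := idfun)) => v c.
exact: (counit_image (M := regular C) (cofE v)).
Qed.
Definition cofree : comodule := @Comodule K C VC cof cof_coassoc cof_counit.

Lemma cof_eps t : tmap (contractr counit) idfun (cof t) = t.
Proof.
move: t; apply: (tensor_eq (f := tmap (contractr counit) idfun \o cof)
  (g := idfun)) => v c /=.
rewrite -[tunassoc _]/(cof (v ⊗ c)) cofE tmap_comp.
have -> : tmap (contractr counit \o tens (tensor_space V C) v) (idfun \o idfun)
   (Delta c) = v ⊗ contractl counit (Delta c); last by rewrite Delta_counitl.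
move: (Delta c) => t; move: t.
apply: (tensor_eq (g := tens (tensor_space V C) v \o contractl counit)) => x y.
by rewrite /= tmapE /= contractrE contractlE linearZl_LR linearZr_LR.
Qed.
End Cofree.

Lemma linear_left_inverse (V W : lmodType K) (f : {linear V -> W}) :
  injective f -> exists s : {linear W -> V}, cancel f s.
Proof.
move=> fI.
have /choice[s sP] (w : sub (image f full)) : exists v, f v = val w.
  by have /subspace_ofP[v _ fv] := valP w; exists v.
have sL : linear s.
  move=> a x y; apply: fI.
  by rewrite linearP !sP (linearP (\val : {linear sub (image f full) -> W})).
pose sl : {linear sub (image f full) -> V} :=
  HB.pack s (GRing.isLinear.Build K (sub (image f full)) V *:%R s sL).
exists (sl \o retr (image f full)) => v; apply: fI.
have fv : f v \in image f full by apply/subspace_ofP; exists v => //; exact: in_full.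
by rewrite /= sP -[f v]/(val (exist (fun w => w \in image f full) _ fv)) retrK.
Qed.

Lemma cofree_injective V : injective_comodule (cofree V).
Proof.
move=> M N f g fC fI gC; have [s sf] := linear_left_inverse fI.
pose b : {linear N -> V} := contractr counit \o g \o s.
pose h : {linear N -> cofree V} := tmap b idfun \o coact.
exists h => [n|m] /=.
  rewrite tmap_comp.
  have -> : tmap (idfun \o b) (Delta \o idfun) (coact n) =
      tmap b (tmap idfun idfun) (tmap idfun Delta (coact n)).
    by rewrite tmap_comp; apply: tmap_ext => // c /=; rewrite tmap_id.
  rewrite -coact_coassoc -tassoc_nat tassocK tmap_comp.
  by apply: tmap_ext.
rewrite fC tmap_comp -[RHS](cof_eps (V := V)).
rewrite (gC m : cof V (g m) = tmap g idfun (coact m)) tmap_comp.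
by apply: tmap_ext => // x /=; rewrite sf.
Qed.

Section QuotientComodule.
Variables (M : comodule) (U : submodClosed M) (sU : subcomodule U).
Fact quo_coact0 m : m \in U -> (tmap (qproj U) idfun \o coact) m = 0.
Proof.
move=> /sU; apply: tmap_kill => a b Ua _.
by rewrite (eqP (_ : qproj U a == 0)) ?pi_eq0 ?linear0l.
Qed.
Definition quo_coact : {linear (M ⧸ U)%type -> ((M ⧸ U) ⊗ C)%type} :=
  quo_lift quo_coact0.
Lemma quo_coactE m : quo_coact (qproj U m) = tmap (qproj U) idfun (coact m).
Proof. exact: quo_liftE. Qed.
Fact quo_coassoc m :
  tassoc (tmap quo_coact idfun (quo_coact m)) = tmap idfun Delta (quo_coact m).
Proof. by have [x <-] := pi_surj m; exact: (coassoc_image quo_coactE). Qed.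
Fact quo_counit m : contractr counit (quo_coact m) = m.
Proof. by have [x <-] := pi_surj m; exact: (counit_image quo_coactE). Qed.
Definition quo_comodule : comodule :=
  @Comodule K C (M ⧸ U)%type quo_coact quo_coassoc quo_counit.
End QuotientComodule.

Lemma in_tsub_full (V W : lmodType K) (t : (V ⊗ W)%type) : t \in tsub full full.
Proof.
move: t; apply: tensor_ind => [|v w t IH]; first exact: rpred0.
by apply: rpredD => //; apply: tsub_in; exact: in_full.
Qed.

Lemma image_subcomodule (M N : comodule) (f : {linear M -> N}) :
  colinear f -> subcomodule (image f full).
Proof.
move=> fC _ /subspace_ofP[m _ <-]; rewrite fC.
apply: tmap_sub (in_tsub_full _) => [a _|b _]; last exact: in_full.
by apply/subspace_ofP; exists a => //; exact: in_full.
Qed.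

Lemma coact_colinear (M : comodule) :
  colinear (coact : {linear M -> cofree (comod M)}).
Proof. by move=> m /=; rewrite -coact_coassoc tassocK. Qed.

Lemma coact_inj (M : comodule) : injective (@coact K C M).
Proof. by move=> x y e; rewrite -[x]coact_counit e coact_counit. Qed.

Definition syzygy (M : comodule) : comodule :=
  quo_comodule (image_subcomodule (@coact_colinear M)).

Fixpoint syz (N : comodule) n : comodule :=
  if n is m.+1 then syzygy (syz N m) else N.

Definition standard_res (N : comodule) n : comodule := cofree (syz N n).

Definition coact_image (M : comodule) : submodClosed (cofree (comod M)) :=
  image (coact : {linear M -> cofree (comod M)}) full.

Definition syz_pi (M : comodule) : {linear cofree (comod M) -> syzygy M} :=
  qproj (coact_image M).

Definition standard_d (N : comodule) n :
    {linear standard_res N n -> standard_res N n.+1} :=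
  (coact : {linear syz N n.+1 -> cofree (comod (syz N n.+1))}) \o syz_pi (syz N n).

Lemma standard_d0 (N : comodule) n (x : cofree (comod (syz N n))) :
  standard_d N n x = 0 <-> exists y : syz N n, coact y = x.
Proof.
split=> [dx|[y <-]].
  have /eqP : syz_pi _ x = 0.
    by apply: (@coact_inj (syz N n.+1)); rewrite linear0; exact: dx.
  by rewrite pi_eq0 => /subspace_ofP[y _ <-]; exists y.
have -> : standard_d N n (coact y) = coact (syz_pi (syz N n) (coact y)) by [].
have /eqP -> : syz_pi (syz N n) (coact y) == 0; last by rewrite linear0.
by rewrite pi_eq0; apply/subspace_ofP; exists y => //; exact: in_full.
Qed.

(* Comodules have enough injectives. *)
Lemma injective_resolution_exists (N : comodule) : injective_resolution N.
Proof.
apply: (@InjectiveResolution N (standard_res N)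
  (coact : {linear N -> cofree (comod N)}) (standard_d N)).
- by move=> n; exact: cofree_injective.
- exact: coact_colinear.
- move=> n x.
  rewrite [LHS](@coact_colinear (syz N n.+1) (syz_pi (syz N n) x)).
  rewrite (_ : coact (syz_pi _ x) = tmap (syz_pi _) idfun (coact x)).
    by rewrite tmap_comp; apply: tmap_ext.
  exact: quo_coactE.
- exact: coact_inj.
- by move=> x; exact: (@standard_d0 N 0).
- move=> n x; rewrite (@standard_d0 N n.+1); split=> [[y <-]|[y <-]].
    by have [z <-] := pi_surj y; exists z.
  by exists (syz_pi (syz N n) y).
Qed.
End Ext.

Section Families.
Variables (K : fieldType) (C : coalgebra K) (I : choiceType).

Definition direct_sum (V : lmodType K) (U : submodClosed V)
    (D : I -> submodClosed V) :=
  (forall x, x \in U <-> exists (s : seq I) (d : I -> V),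
     (forall i, d i \in D i) /\ x = \sum_(i <- s) d i) /\
  (forall (s : seq I) (d : I -> V), uniq s -> (forall i, d i \in D i) ->
     \sum_(i <- s) d i = 0 -> forall i, i \in s -> d i = 0).

Definition coradical_decomposition (D : I -> submodClosed C) :=
  (forall i, simple_subcoalgebra (D i)) /\ direct_sum (coradical C) D.

(* The isomorphism of n S with the right comodule D is given as an injective
   comodule map from n S to C with image D. *)
Definition iso_power (D : submodClosed C) (S : comodule C) (n : nat) :=
  exists f : {linear comod_pow n S -> regular C},
    [/\ colinear f, injective f & forall c, c \in D <-> exists x, f x = c].

Record complete_simples (D : I -> submodClosed C) (S : I -> comodule C) : Prop :=
  CompleteSimples {
    simples_simple : forall i, simple_comodule (S i);
    simples_distinct : forall i j, comod_iso (S i) (S j) -> i = j;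
    simples_complete : forall M : comodule C, simple_comodule M ->
      exists i, comod_iso M (S i);
    simples_power : forall i, exists n : nat, iso_power (D i) (S i) n }.
End Families.

(* Main.v *)
Require Import Defs.
From HB Require Import structures.
From mathcomp Require Import all_boot all_algebra.
From mathcomp Require Import boolp classical_sets functions cardinality.
(* From here on [preim], [image] and [span] are the operations on subspaces. *)
Import Defs.

Import GRing.Theory.
Local Open Scope ring_scope.

(** Write Q = C / C_0 and let T be the right translation c |-> sum f(c_1) c_2 by a
    functional f that extends e_j from D^j to C and vanishes on the other simple
    subcoalgebras. Then T is an endomorphism of the right comodule C, and its image
    on C_0 is D^j . e_j, which is isomorphic to S_j because e_j is primitive
    ([primitive_embedding]). Both spaces of the theorem are identified with
      H = { phi in Hom_C(S_i, Q) | phi is fixed by the endomorphism of Q induced by T }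
    and a basis of H is transported to each of them ([same_dim_bij2]).

    Evaluation. Choose a nonzero u in S_i with e_i . u = u. A comodule map out of the
    simple comodule S_i has its values in C_1 / C_0 and is determined by its value at
    u, which lies in e_i . ^j(C_1/C_0)^i . e_j when the map is in H. Every element of
    that space is such a value, because S_i is generated by u with the relations of
    the simple left ideal (D^i)^* e_i ([evaluation_surj]). So H is isomorphic to the
    Gabriel space ([eval_fixed_bij]).

    Extensions. Heuristically, the injective hull of S_j is C . e for an idempotent e
    lifting e_j, and Ext^1(S_i, S_j) is Hom(S_i, (C_1/C_0) . e_j) = H. To
    see this through C itself: it is injective, being cofree on K ([colift]), and T
    maps C_0 into the copy of S_j in C, hence induces a map from Q to the quotient of C
    by this copy. Given an arbitrary injective resolution of S_j, this yields a map
    from Q to the kernel of its differential in degree 1, and composition with it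
    induces an isomorphism from H to Ext^1(S_i, S_j) ([fixed_hom_Ext1]). It is bijective because a comodule map from S_i to C always lands in C_0, so the
    ambiguity of lifts disappears in Q. *)

Set Implicit Arguments.
Unset Strict Implicit.
Unset Printing Implicit Defensive.

(** * Bases and dimension *)

Section Bases.
Variables (K : fieldType).

(** A maximal free set spans: a vector outside its span could be added to it.
    The union of a chain of free sets is free because a relation involves
    finitely many vectors. *)
Lemma basis_exists (V : lmodType K) : exists B : set V, is_basis B.
Proof.
have [F FP totF|B [freeB maxB]] := @Zorn_bigcup V (@free_family K V).
  move=> s a us sF.
  suff [A fA sA] : exists2 A, free_family A & forall x, x \in s -> A x by exact: fA.
  have [s0|[A FA sA]] : s = [::] \/ exists2 A, F A & forall x, x \in s -> A x.
  - elim: s {us} sF => [|x s IH] sF; first by left.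
    have [A FA Ax] := sF x (mem_head x s); right.
    have [->|[A' FA' sA']] := IH (fun y ys => sF y (mem_behead (s := x :: s) ys)).
      by exists A => // y; rewrite inE => /eqP ->.
    have [AA'|A'A] := totF A A' FA FA'.
      by exists A' => // y; rewrite inE => /orP[/eqP ->|/sA' //]; exact: AA'.
    by exists A => // y; rewrite inE => /orP[/eqP -> //|/sA' /A'A].
  - by exists set0; rewrite ?s0 // => t b _ tn _ x /tn.
  by exists A => //; exact: FP.
exists B; split=> // v; apply: contrapT => Nv.
have BsubBv : (B `<` B `|` [set v])%classic.
  split; first by move=> x; left.
  move=> /(_ v (or_intror erefl)) Bv; apply: Nv; exists [:: v], (fun=> 1).
  by rewrite big_seq1 scale1r; split=> // x; rewrite inE => /eqP ->.
apply: (maxB _ BsubBv) => s a us sBv sum0.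
have BE x : x \in s -> x != v -> B x.
  by move=> xs xv; case: (sBv x xs) => // xv'; rewrite xv' eqxx in xv.
have [vs|vs] := boolP (v \in s); last first.
  by apply: (freeB s a) => // x xs; apply: BE => //; apply: contraNneq vs => <-.
have rB x : x \in rem v s -> B x.
  rewrite mem_rem_uniq // inE => /andP[xv xs]; exact: BE.
move: sum0; rewrite (perm_big _ (perm_to_rem vs)) big_cons /= => sum0.
have av : a v = 0.
  apply: contrapT => /eqP av; apply: Nv.
  exists (rem v s), (fun x => - (a v)^-1 * a x); split=> //.
  under eq_bigr do rewrite -scalerA.
  rewrite -scaler_sumr -[\sum_(_ <- _) _](addKr (a v *: v)) sum0 addr0.
  by rewrite scaleNr scalerN opprK scalerA mulVf // scale1r.
move: sum0; rewrite av scale0r add0r => sum0 x xs.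
have [-> //|xv] := eqVneq x v.
apply: (freeB (rem v s) a) => //; first exact: rem_uniq.
by rewrite mem_rem_uniq // inE xv.
Qed.

Lemma basis_bij (V W : lmodType K) (f : {linear V -> W}) (B : set V) :
  bijective f -> is_basis B -> is_basis (f @` B)%classic.
Proof.
move=> [g fK gK] [freeB spanB]; split=> [s a us sB sum0 y ys|w].
  have mapK t : [seq f x | x <- [seq g y | y <- t]] = t.
    by rewrite -map_comp map_id_in // => z _ /=; exact: gK.
  rewrite -(gK y).
  apply: (freeB [seq g y | y <- s] (a \o f)); last by rewrite map_f.
  - by rewrite map_inj_uniq //; exact: can_inj gK.
  - by move=> _ /mapP[z zs ->]; have [x Bx <-] := sB z zs; rewrite fK.
  apply: (can_inj fK); rewrite linear0 -sum0 big_map linear_sum.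
  by apply: eq_bigr => z _; rewrite linearZ /= gK.
have [s [a [sB gw]]] := spanB (g w).
exists [seq f x | x <- s], (a \o g); split.
  by move=> _ /mapP[x xs ->]; exists x => //; exact: sB.
rewrite -(gK w) gw linear_sum big_map.
by apply: eq_bigr => z _; rewrite linearZ /= fK.
Qed.

(** Both sides are compared through a third space, whose basis is transported
    along the two bijections. *)
Lemma same_dim_bij2 (V W1 W2 : lmodType K) (f : {linear V -> W1})
    (g : {linear V -> W2}) : bijective f -> bijective g -> same_dim W1 W2.
Proof.
move=> bf bg; have [B basB] := basis_exists V.
exists (f @` B)%classic, (g @` B)%classic; split; [exact: basis_bij..|].
have cf := inj_card_eq (A := B) (in2W (bij_inj bf)).
have cg := inj_card_eq (A := B) (in2W (bij_inj bg)).
exact: card_eq_trans cf (card_eq_trans (card_eqxx B) (card_esym cg)).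
Qed.
End Bases.

(** * Linear maps and tensors *)

Section LinearAlgebra.
Variable K : fieldType.
Implicit Types V W : lmodType K.

(** A left inverse of the injection of the line through [w]. *)
Lemma scalar_separates W (w : W) : w != 0 -> exists g : {scalar W}, g w = 1.
Proof.
move=> w0.
have lL : linear (fun a : K^o => a *: w) by move=> a x y; rewrite scalerDl scalerA.
pose l : {linear K^o -> W} := HB.pack (fun a : K^o => a *: w)
  (GRing.isLinear.Build K K^o W *:%R _ lL).
have lI : injective l.
  move=> a b /= /eqP; rewrite -subr_eq0 -scalerBl scaler_eq0 (negPf w0) orbF.
  by rewrite subr_eq0 => /eqP.
have [s sl] := linear_left_inverse lI.
have sL : scalar (fun x => s x : K) by move=> a x y; rewrite linearP.
pose g : {scalar W} := HB.pack (fun x => s x : K) (GRing.isLinear.Build K W K *%R _ sL).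
by exists g; have := sl 1; rewrite /= scale1r.
Qed.

Lemma linear_bij V W (f : {linear V -> W}) :
  injective f -> (forall w, exists v, f v = w) -> bijective f.
Proof.
move=> fI fS; have [g fK] := linear_left_inverse fI.
by exists g => // w; have [v <-] := fS w; rewrite fK.
Qed.

(** Used to lift along a map whose kernel and image are only known abstractly:
    [d] is inverted on a complement of its kernel. *)
Lemma generalized_inverse V W (d : {linear V -> W}) :
  exists s : {linear W -> V}, forall v, d (s (d v)) = d v.
Proof.
have [U [kU VkU]] := complement_exists (ker d).
have dI : injective (d \o (\val : {linear sub U -> V})).
  move=> x y /= /eqP; rewrite -subr_eq0 -linearB => /eqP dxy.
  apply/val_inj/eqP; rewrite -subr_eq0; apply/eqP/kU; first exact/subspace_ofP.
  by rewrite -[_ - _](raddfB (\val : {linear sub U -> V})); exact: valP.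
have [s sK] := linear_left_inverse dI.
exists ((\val : {linear sub U -> V}) \o s) => v.
have [k [w [/subspace_ofP dk Uw ->]]] := VkU v.
by rewrite linearD dk add0r; have := sK (exist _ w Uw) => /= ->.
Qed.

(** A finite rank operator agreeing with the identity on finitely many given
    vectors. It replaces the choice of a basis of a finite-dimensional subspace,
    so that tensors can be studied through contractions against functionals. *)
Lemma finite_rank_identity W (s : seq W) : exists p : seq ({scalar W} * W),
  forall w, w \in s -> \sum_(k <- p) k.1 w *: k.2 = w.
Proof.
elim: s => [|v s [p ps]]; first by exists [::].
(* P fixes the tail; P + (g o (1 - P)) (v - P v) with g (v - P v) = 1 also fixes v. *)
pose P (w : W) := \sum_(k <- p) k.1 w *: k.2.
have [v0|v0] := eqVneq (v - P v) 0.
  exists p => w; rewrite inE => /orP[/eqP ->|/ps //].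
  by move/eqP: v0; rewrite subr_eq0 => /eqP.
have PL : linear (fun w => w - P w).
  move=> a x y; rewrite /P scalerBr addrACA -opprD scaler_sumr -big_split /=.
  congr (_ - _); apply: eq_bigr => k _.
  by rewrite linearP scalerDl scalerA.
pose q : {linear W -> W} := HB.pack (fun w => w - P w)
  (GRing.isLinear.Build K W W *:%R _ PL).
have [g gv] := scalar_separates v0.
exists ((g \o q : {scalar W}, v - P v) :: p) => w; rewrite big_cons /= -/(P w).
rewrite inE => /orP[/eqP ->|/ps ws]; first by rewrite gv scale1r subrK.
by rewrite /P ws subrr linear0 scale0r add0r.
Qed.

(** A tensor involves finitely many vectors of [W]; applying to its second
    factor a finite rank operator that fixes them rewrites it in terms of its
    contractions. *)
Lemma tensor_expandr V W (t : (V ⊗ W)%type) : exists p : seq ({scalar W} * W),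
  t = \sum_(k <- p) contractr k.1 t ⊗ k.2.
Proof.
suff [s sP] : exists s : seq W, forall p : seq ({scalar W} * W),
    (forall w, w \in s -> \sum_(k <- p) k.1 w *: k.2 = w) ->
    t = \sum_(k <- p) contractr k.1 t ⊗ k.2.
  by have [p /sP] := finite_rank_identity s; exists p.
move: t; apply: tensor_ind => [|v w t [s sP]].
  by exists [::] => p _; rewrite big1 // => k _; rewrite linear0 linear0l.
exists (w :: s) => p ps.
under eq_bigr do rewrite linearD linearDl.
rewrite big_split /= -sP => [|x xs]; last by apply: ps; rewrite inE xs orbT.
congr (_ + _); rewrite -[w in LHS](ps w (mem_head _ _)) linear_sumr.
by apply: eq_bigr => k _; rewrite contractrE linearZr_LR linearZl_LR.
Qed.

(** Over a field, functionals on one factor separate tensors. *)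
Lemma tensor_extr V W (t t' : (V ⊗ W)%type) :
  (forall g : {scalar W}, contractr g t = contractr g t') -> t = t'.
Proof.
move=> tt'; apply/eqP; rewrite -subr_eq0; have [p ->] := tensor_expandr (t - t').
by apply/eqP/big1 => k _; rewrite linearB tt' subrr linear0l.
Qed.

Lemma tensor_expandl V W (t : (V ⊗ W)%type) : exists p : seq ({scalar V} * V),
  t = \sum_(k <- p) k.2 ⊗ contractl k.1 t.
Proof.
suff [s sP] : exists s : seq V, forall p : seq ({scalar V} * V),
    (forall w, w \in s -> \sum_(k <- p) k.1 w *: k.2 = w) ->
    t = \sum_(k <- p) k.2 ⊗ contractl k.1 t.
  by have [p /sP] := finite_rank_identity s; exists p.
move: t; apply: tensor_ind => [|v w t [s sP]].
  by exists [::] => p _; rewrite big1 // => k _; rewrite linear0 linear0r.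
exists (v :: s) => p ps.
under eq_bigr do rewrite linearD linearDr.
rewrite big_split /= -sP => [|x xs]; last by apply: ps; rewrite inE xs orbT.
congr (_ + _); rewrite -[v in LHS](ps v (mem_head _ _)) linear_sumlz.
by apply: eq_bigr => k _; rewrite contractlE linearZr_LR linearZl_LR.
Qed.

Lemma tsub_contractr V W (A : submodClosed V) (t : (V ⊗ W)%type) :
  (forall g : {scalar W}, contractr g t \in A) -> t \in tsub A full.
Proof.
move=> tA; have [p ->] := tensor_expandr t.
by apply: rpred_sum => k _; apply: tsub_in; [exact: tA|exact: in_full].
Qed.

Lemma tsub_contractl V W (B : submodClosed W) (t : (V ⊗ W)%type) :
  (forall g : {scalar V}, contractl g t \in B) -> t \in tsub full B.
Proof.
move=> tB; have [p ->] := tensor_expandl t.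
by apply: rpred_sum => k _; apply: tsub_in; [exact: in_full|exact: tB].
Qed.

(** Two pairs of maps that agree on subspaces carrying the tensor agree on the
    tensor; the projector onto the subspaces is the typical second pair. *)
Lemma tmap_eq_in V V' W W' (A : submodClosed V) (B : submodClosed W)
    (f f' : {linear V -> V'}) (g g' : {linear W -> W'}) t :
  {in A, f =1 f'} -> {in B, g =1 g'} -> t \in tsub A B ->
  tmap f g t = tmap f' g' t.
Proof.
move=> ff gg tAB; apply/eqP; rewrite -subr_eq0; apply/eqP.
have: t \in ker (tmap f g \- tmap f' g'); last by move/subspace_ofP.
apply: span_sub tAB => _ [a [b [Aa Bb ->]]]; apply/subspace_ofP.
by rewrite /= !tmapE ff // gg // subrr.
Qed.

Definition projector V (A : submodClosed V) : {linear V -> V} :=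
  (\val : {linear sub A -> V}) \o retr A.

Lemma projector_in V (A : submodClosed V) v : projector A v \in A.
Proof. exact: valP. Qed.

Lemma projector_id V (A : submodClosed V) : {in A, projector A =1 idfun}.
Proof. by move=> v Av; have := retrK (exist (fun x => x \in A) v Av) => /= ->. Qed.

Lemma tsub_meet V W (A : submodClosed V) (B : submodClosed W) t :
  t \in tsub A full -> t \in tsub full B -> t \in tsub A B.
Proof.
move=> tA tB.
rewrite -[t](tmap_id (f := idfun) (g := idfun)) //.
rewrite -(tmap_eq_in (f := idfun) (g := projector B) _ _ tB) //; last exact: projector_id.
apply: tmap_sub tA => [|b _]; [by []|exact: projector_in].
Qed.

Lemma contractl_eq_in V W (A : submodClosed V) (f f' : {scalar V}) (t : (V ⊗ W)%type) :
  {in A, f =1 f'} -> t \in tsub A full -> contractl f t = contractl f' t.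
Proof.
move=> ff tA; apply/eqP; rewrite -subr_eq0; apply/eqP.
have: t \in ker (contractl f \- contractl f'); last by move/subspace_ofP.
apply: span_sub tA => _ [a [b [Aa Bb ->]]]; apply/subspace_ofP.
by rewrite /= !contractlE ff // subrr.
Qed.

Lemma contractr_eq_in V W (B : submodClosed W) (f f' : {scalar W}) (t : (V ⊗ W)%type) :
  {in B, f =1 f'} -> t \in tsub full B -> contractr f t = contractr f' t.
Proof.
move=> ff tA; apply/eqP; rewrite -subr_eq0; apply/eqP.
have: t \in ker (contractr f \- contractr f'); last by move/subspace_ofP.
apply: span_sub tA => _ [a [b [Aa Bb ->]]]; apply/subspace_ofP.
by rewrite /= !contractrE ff // subrr.
Qed.

Lemma tsub_mono V W (A A' : submodClosed V) (B B' : submodClosed W) t :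
  {subset A <= A'} -> {subset B <= B'} -> t \in tsub A B -> t \in tsub A' B'.
Proof.
move=> AA BB; apply: span_sub => _ [a [b [Aa Bb ->]]].
by apply: tsub_in; [exact: AA|exact: BB].
Qed.

Lemma contractr_lin V W (f g h : {scalar W}) a (t : (V ⊗ W)%type) :
  (forall w, h w = a * f w + g w) ->
  contractr h t = a *: contractr f t + contractr g t.
Proof.
move=> hE; move: t.
apply: (tensor_eq (g := (a \*: contractr f) \+ contractr g)) => v w.
by rewrite /= !contractrE hE scalerDl scalerA.
Qed.

Lemma contractl_lin V W (f g h : {scalar V}) a (t : (V ⊗ W)%type) :
  (forall v, h v = a * f v + g v) ->
  contractl h t = a *: contractl f t + contractl g t.
Proof.
move=> hE; move: t.
apply: (tensor_eq (g := (a \*: contractl f) \+ contractl g)) => v w.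
by rewrite /= !contractlE hE scalerDl scalerA.
Qed.

Lemma contractl0 V W (t : (V ⊗ W)%type) : contractl (\0 : {scalar V}) t = 0.
Proof.
move: t; apply: (tensor_eq (f := contractl \0) (g := \0)) => v w.
by rewrite contractlE scale0r.
Qed.

Lemma contractr0 V W (t : (V ⊗ W)%type) : contractr (\0 : {scalar W}) t = 0.
Proof.
move: t; apply: (tensor_eq (f := contractr \0) (g := \0)) => v w.
by rewrite contractrE scale0r.
Qed.

Lemma contractl_in V W (B : submodClosed W) (f : {scalar V}) (t : (V ⊗ W)%type) :
  t \in tsub full B -> contractl f t \in B.
Proof.
move=> tB; have: t \in preim (contractl f) B; last by move/subspace_ofP.
apply: span_sub tB => _ [a [b [Aa Bb ->]]]; apply/subspace_ofP.
by rewrite contractlE; exact: rpredZ.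
Qed.

Lemma contractr_in V W (A : submodClosed V) (f : {scalar W}) (t : (V ⊗ W)%type) :
  t \in tsub A full -> contractr f t \in A.
Proof.
move=> tA; have: t \in preim (contractr f) A; last by move/subspace_ofP.
apply: span_sub tA => _ [a [b [Aa Bb ->]]]; apply/subspace_ofP.
by rewrite contractrE; exact: rpredZ.
Qed.

Lemma contractl_tmap V V' W W' (f : {scalar V'}) (g : {linear V -> V'})
    (h : {linear W -> W'}) t :
  contractl f (tmap g h t) = h (contractl (f \o g) t).
Proof.
move: t; apply: (tensor_eq (f := contractl f \o tmap g h)
  (g := h \o contractl (f \o g))) => v w.
by rewrite /= tmapE !contractlE linearZ_LR.
Qed.

Lemma contractr_tmap V V' W W' (f : {scalar W'}) (g : {linear V -> V'})
    (h : {linear W -> W'}) t :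
  contractr f (tmap g h t) = g (contractr (f \o h) t).
Proof.
move: t; apply: (tensor_eq (f := contractr f \o tmap g h)
  (g := g \o contractr (f \o h))) => v w.
by rewrite /= tmapE !contractrE linearZ_LR.
Qed.

Lemma contractl_nat V W W' (f : {scalar V}) (h : {linear W -> W'}) t :
  contractl f (tmap idfun h t) = h (contractl f t).
Proof.
move: t; apply: (tensor_eq (f := contractl f \o tmap idfun h)
  (g := h \o contractl f)) => v w.
by rewrite /= tmapE !contractlE linearZ_LR.
Qed.

(** Both sides are the value of the functional f (x) g on [t]. *)
Lemma contract_comm V W (f : {scalar V}) (g : {scalar W}) (t : (V ⊗ W)%type) :
  f (contractr g t) = g (contractl f t).
Proof.
move: t; apply: tensor_ind => [|v w t IH]; first by rewrite !linear0.
by rewrite !linearD /= IH contractlE contractrE !linearZ /= mulrC.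
Qed.

Lemma contractl_tassoc (U V W : lmodType K) (f : {scalar U}) (t : ((U ⊗ V) ⊗ W)%type) :
  contractl f (tassoc t) = tmap (contractl f) idfun t.
Proof.
move: t; apply: (tensor_eq (f := contractl f \o tassoc)
  (g := tmap (contractl f) idfun)) => x w /=; move: x.
apply: tensor_ind => [|u v x IH]; first by rewrite linear0l !linear0.
rewrite linearDl !linearD /= IH tassocE contractlE !tmapE contractlE.
by rewrite linearZl_LR.
Qed.

Lemma contractr_tassoc (U V W : lmodType K) (f : {scalar W}) (t : ((U ⊗ V) ⊗ W)%type) :
  tmap idfun (contractr f) (tassoc t) = contractr f t.
Proof.
move: t; apply: (tensor_eq (f := tmap idfun (contractr f) \o tassoc)
  (g := contractr f)) => x w /=; move: x.
apply: tensor_ind => [|u v x IH]; first by rewrite linear0l !linear0.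
rewrite linearDl !linearD /= IH tassocE tmapE !contractrE.
by rewrite linearZr_LR.
Qed.
End LinearAlgebra.

(** * Functionals, comodule maps and Schur's lemma *)

Section CoalgebraActions.
Variables (K : fieldType) (C : coalgebra K).
Implicit Types M N P Q : comodule C.

(** The regular comodule is cofree on K: Hom_C(M, C) is the dual of M, through
    Phi |-> counit o Phi. This is the map m |-> sum f(m_0) m_1 corresponding to
    [f]. On [M = C] it is right translation c |-> sum f(c_1) c_2, and every
    comodule endomorphism of C has this form. *)
Definition colift M (f : {scalar M}) : {linear M -> C} := contractl f \o coact.

(** The left action m |-> sum m_0 f(m_1) of the dual algebra; it commutes with
    every comodule map. *)
Definition dual_act M (f : {scalar C}) : {linear M -> M} := contractr f \o coact.

Lemma colift_colinear M (f : {scalar M}) : @colinear _ _ M (regular C) (colift f).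
Proof.
move=> m; rewrite /colift /=.
rewrite -contractl_nat.
rewrite -coact_coassoc contractl_tassoc tmap_comp.
by apply: tmap_ext.
Qed.

(** Stated at one element, so that it also applies to maps that are colinear on
    a subspace only. *)
Lemma coliftE M (f : {linear M -> C}) m :
  Delta (f m) = tmap f idfun (coact m) -> colift (counit \o f : {scalar M}) m = f m.
Proof.
move=> fm; rewrite -[RHS]Delta_counitl fm contractl_tmap.
by [].
Qed.

Lemma counit_colift M (f : {scalar M}) m : counit (colift f m) = f m.
Proof. by rewrite -contract_comm coact_counit. Qed.

Lemma dual_act_colinear M N (f : {scalar C}) (F : {linear M -> N}) :
  colinear F -> forall m, F (dual_act M f m) = dual_act N f (F m).
Proof. by move=> FC m; rewrite /dual_act /= FC contractr_nat. Qed.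

Lemma coact_dual_act M (f : {scalar C}) m :
  coact (dual_act M f m) = tmap idfun (dual_act (regular C) f) (coact m).
Proof.
rewrite /dual_act /= -contractr_nat -contractr_tassoc coact_coassoc tmap_comp.
by apply: tmap_ext.
Qed.

(** The functional on the right is the convolution of [f] and [g], applied to
    the coaction. *)
Lemma dual_actM M (f g : {scalar C}) m :
  dual_act M f (dual_act M g m) =
    contractr (f \o dual_act (regular C) g : {scalar C}) (coact m).
Proof. by rewrite {1}/dual_act /= coact_dual_act contractr_tmap. Qed.

Lemma colinear_comp M N P (f : {linear M -> N}) (g : {linear N -> P}) :
  colinear f -> colinear g -> colinear (g \o f).
Proof.
move=> fC gC m; rewrite /= gC fC tmap_comp.
by apply: tmap_ext.
Qed.

Lemma colinear_sub M N (f g : {linear M -> N}) :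
  colinear f -> colinear g -> colinear (f \- g).
Proof.
move=> fC gC m; rewrite /= linearB /= fC gC.
have -> : tmap f idfun (coact m) =
    tmap ((f \- g) \+ g) idfun (coact m) by apply: tmap_ext => // x /=; rewrite subrK.
rewrite (@tmapDl _ _ _ _ _ (f \- g) g _ _ 1) ?scale1r ?addrK // => v /=.
by rewrite scale1r.
Qed.

Lemma colinear_inv M N (f : {linear M -> N}) (g : {linear N -> M}) :
  colinear f -> cancel f g -> cancel g f -> colinear g.
Proof.
by move=> fC fK gK n; rewrite -{2}(gK n) fC tmap_comp tmap_id.
Qed.

(** Contractions of the coaction of an element of the kernel stay in the kernel,
    and this is enough by [tsub_contractr]. *)
Lemma subcomodule_ker M N (f : {linear M -> N}) : colinear f -> subcomodule (ker f).
Proof.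
move=> fC m /subspace_ofP fm; apply: tsub_contractr => g; apply/subspace_ofP.
by rewrite -contractr_nat -fC fm !linear0.
Qed.

Lemma simple_vanish M N (f : {linear M -> N}) u : simple_comodule M ->
  colinear f -> u != 0 -> f u = 0 -> forall m, f m = 0.
Proof.
move=> [_ simM] fC u0 fu m; have: m \in ker f; last by move/subspace_ofP.
by apply: (simM _ (subcomodule_ker fC)); exists u => //; apply/subspace_ofP.
Qed.

Lemma simple_inj M N (f : {linear M -> N}) m : simple_comodule M ->
  colinear f -> f m != 0 -> injective f.
Proof.
move=> simM fC fm x y fxy; apply/eqP; rewrite -subr_eq0; apply: contraT => xy.
have fxy0 : f (x - y) = 0 by rewrite linearB fxy subrr.
by rewrite (simple_vanish simM fC xy fxy0) eqxx in fm.
Qed.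

Lemma simple_surj M N (f : {linear M -> N}) m : simple_comodule N ->
  colinear f -> f m != 0 -> forall y, exists x, f x = y.
Proof.
move=> [_ simN] fC fm y.
have: y \in image f full; last by move/subspace_ofP => [x _ <-]; exists x.
apply: (simN _ (image_subcomodule fC)); exists (f m) => //.
by apply/subspace_ofP; exists m => //; exact: in_full.
Qed.

Lemma schur M (f : {linear M -> M}) m : simple_comodule M -> colinear f ->
  f m != 0 -> exists g : {linear M -> M}, [/\ colinear g, cancel f g & cancel g f].
Proof.
move=> simM fC fm; have [g fK] := linear_left_inverse (simple_inj simM fC fm).
have gK : cancel g f.
  by move=> y; have [x <-] := simple_surj simM fC fm y; rewrite fK.
by exists g; split=> //; exact: colinear_inv gK.
Qed.

Lemma dual_act_lin M (f g h : {scalar C}) a m : (forall c, h c = a * f c + g c) ->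
  dual_act M h m = a *: dual_act M f m + dual_act M g m.
Proof. by move=> hE; exact: contractr_lin. Qed.

Lemma dual_act0 M m : dual_act M \0 m = 0.
Proof. exact: contractr0. Qed.

(** The vectors f.u form a subcomodule, which contains u = counit.u. *)
Lemma dual_act_generates M (u : M) : simple_comodule M -> u != 0 ->
  forall m, exists f, dual_act M f u = m.
Proof.
move=> [_ simM] u0 m.
have clN : subsemimod_closed (asPred (fun x : M => exists f, dual_act M f u = x)).
  apply: closedPP => [|_ _ [f <-] [g <-]|a _ [f <-]].
  - by exists (\0 : {scalar C}); apply: dual_act0.
  - exists (f \+ g : {scalar C}); rewrite (@dual_act_lin _ f g _ 1) ?scale1r // => c.
    by rewrite mul1r.
  - have afL : scalar (fun c => a * f c).
      by move=> b x y; rewrite linearP mulrDr mulrCA.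
    exists (HB.pack (fun c => a * f c) (GRing.isLinear.Build K C K *%R _ afL) : {scalar C}).
    by rewrite (@dual_act_lin _ f \0 _ a) ?dual_act0 ?addr0 // => c /=; rewrite addr0.
have: m \in subspace_of clN; last by move/subspace_ofP.
apply: simM => [x /subspace_ofP[f <-]|].
  apply: tsub_contractr => g; apply/subspace_ofP.
  by exists (g \o dual_act (regular C) f : {scalar C}); exact: esym (dual_actM g f u).
exists u => //; apply/subspace_ofP; exists counit; exact: coact_counit.
Qed.

(** The map [b] factors through the image of [d], in which [f] takes its values.
    Every induced map below comes from this lemma: maps out of a quotient, when
    [f] is the identity, and lifts along the first differential of a resolution.
    *)
Lemma colinear_descent M N P Q (d : {linear M -> N}) (f : {linear P -> N})
    (b : {linear M -> Q}) :
  colinear d -> colinear f -> colinear b ->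
  (forall p, exists m, d m = f p) -> (forall m, d m = 0 -> b m = 0) ->
  exists2 g : {linear P -> Q}, colinear g & forall p m, d m = f p -> g p = b m.
Proof.
move=> dC fC bC fd db; have [s sP] := generalized_inverse d.
have bE m : b (s (d m)) = b m.
  by apply/eqP; rewrite -subr_eq0 -linearB; apply/eqP/db; rewrite linearB sP subrr.
have gE p m : d m = f p -> (b \o s \o f) p = b m by move=> dm; rewrite /= -dm bE.
exists (b \o s \o f) => // p; have [m dm] := fd p.
transitivity (coact (b m)); first exact: congr1 (gE p m dm).
rewrite bC.
have -> : tmap (b \o s \o f) idfun (coact p) = tmap (b \o s) idfun (coact (f p)).
  by rewrite fC tmap_comp; apply: tmap_ext.
rewrite -dm dC tmap_comp; apply: tmap_ext => // x /=.
by rewrite bE.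
Qed.
End CoalgebraActions.

(** * Maps colinear on a subcoalgebra *)

Section ColinearOn.
Variables (K : fieldType) (C : coalgebra K).
Implicit Types M N P : comodule C.

(** Maps out of a subcoalgebra D of C are written as linear maps on all of C
    whose restriction to D is colinear, so that they compose with translations.
    *)
Definition colinear_on M N (A : submodClosed M) (f : {linear M -> N}) :=
  forall m, m \in A -> coact (f m) = tmap f idfun (coact m).

Lemma colinear_on_comp M N P (A : submodClosed M) (B : submodClosed N)
    (f : {linear M -> N}) (g : {linear N -> P}) :
  colinear_on A f -> (forall m, m \in A -> f m \in B) -> colinear_on B g ->
  colinear_on A (g \o f).
Proof.
move=> fC fAB gC m Am; rewrite /= (gC _ (fAB m Am)) (fC _ Am) tmap_comp.
by apply: tmap_ext.
Qed.

(** If [f] factors through the injective comodule map [j] on [A], then the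
    factor is colinear on [A] as well: apply the retraction to the colinearity
    of [f]. *)
Lemma colinear_corestrict M N P (A : submodClosed M) (f : {linear M -> P})
    (j : {linear N -> P}) (r : {linear P -> N}) :
  colinear j -> cancel j r -> colinear_on A f ->
  (forall m, m \in A -> j (r (f m)) = f m) -> colinear_on A (r \o f).
Proof.
move=> jC jK fC jrf m Am.
have rK t : tmap r idfun (tmap j idfun t) = t :> (N ⊗ C)%type.
  by rewrite tmap_comp tmap_id.
rewrite -[LHS]rK -jC /= jrf // fC // tmap_comp.
by apply: tmap_ext.
Qed.

Variable D : submodClosed C.
Hypothesis subD : subcoalgebra D.

Lemma subcoalgebra_coactl c : c \in D -> Delta c \in tsub D full.
Proof. by move/subD; apply: tsub_mono => // x _; exact: in_full. Qed.

Lemma subcoalgebra_coactr c : c \in D -> Delta c \in tsub full D.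
Proof. by move/subD; apply: tsub_mono => // x _; exact: in_full. Qed.

Local Notation T := (@colift K C (regular C)).

Lemma colift_subcoalgebra (f : {scalar C}) c : c \in D -> T f c \in D.
Proof. by move/subcoalgebra_coactr; exact: contractl_in. Qed.

Lemma colift_colinear_on (f : {scalar C}) :
  @colinear_on (regular C) (regular C) D (T f).
Proof. by move=> c _; exact: colift_colinear. Qed.

(** Cofreeness again: a colinear map into C is determined by its composite with
    the counit. *)
Lemma colinear_on_ext (f g : {linear C -> C}) :
  @colinear_on (regular C) (regular C) D f ->
  @colinear_on (regular C) (regular C) D g ->
  (forall c, c \in D -> counit (f c) = counit (g c)) ->
  forall c, c \in D -> f c = g c.
Proof.
move=> fC gC fg c Dc.
rewrite -(@coliftE _ _ (regular C) f c (fC c Dc)) -(@coliftE _ _ (regular C) g c (gC c Dc)).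
by apply: contractl_eq_in (subcoalgebra_coactl Dc) => d /fg.
Qed.
End ColinearOn.

(** * Primitive idempotents of the dual algebra *)

Section PrimitiveForms.
Variables (K : fieldType) (C : coalgebra K) (D : submodClosed C).
Hypothesis subD : subcoalgebra D.
Local Notation T := (@colift K C (regular C)).

(** Convolution is composition with a translation, (f * g)(c) = g (colift f c),
    so idempotency on D reads as follows for a functional on C. *)
Definition idempotent_on (f : {scalar C}) := forall c, c \in D -> f (T f c) = f c.

(** Primitivity in the dual algebra of D, expressed with functionals on C; by
    [conv_extend] only their restrictions to D matter. *)
Definition primitive_on (e : {scalar C}) :=
  [/\ idempotent_on e, exists2 c, c \in D & e c != 0 &
    forall f g : {scalar C}, idempotent_on f -> idempotent_on g ->
      (forall c, c \in D -> g (T f c) = 0) -> (forall c, c \in D -> f (T g c) = 0) ->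
      (forall c, c \in D -> e c = f c + g c) ->
      (forall c, c \in D -> f c = 0) \/ (forall c, c \in D -> g c = 0)].

Lemma conv_extend (f g : {scalar sub D}) (f' g' : {scalar C}) (c : sub D) :
  (forall d : sub D, f' (val d) = f d) -> (forall d : sub D, g' (val d) = g d) ->
  conv f g c = g' (T f' (val c)).
Proof.
move=> ff gg; rewrite -[RHS]contract_comm.
rewrite -[@coact K C (regular C) _]/(Delta (val c)) -(DeltaD_val c subD) contractr_tmap ff.
apply: (congr1 f); apply: (@contractr_eq_in _ _ _ full) (in_tsub_full _) => d _.
exact: esym (gg d).
Qed.

Lemma primitive_extend (e : {scalar sub D}) (e' : {scalar C}) :
  (forall d : sub D, e' (val d) = e d) -> primitive_idempotent e -> primitive_on e'.
Proof.
move=> ee [eI [c0 ec0] eP].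
pose res (f : {scalar C}) : {scalar sub D} := f \o (\val : {linear sub D -> C}).
have resI f : idempotent_on f -> idempotent_form (res f).
  by move=> fI d; rewrite (@conv_extend _ _ f f) // fI //; exact: valP.
have sD c (Dc : c \in D) : c = val (exist (fun c => c \in D) c Dc) by [].
split=> [c Dc||f g fI gI fg gf efg].
- by rewrite (sD c Dc) -(@conv_extend e e) // eI ee.
- by exists (val c0); [exact: valP|rewrite ee].
have [d|d|d|f0|g0] := eP (res f) (res g) (resI f fI) (resI g gI).
- by rewrite (@conv_extend _ _ f g) // fg //; exact: valP.
- by rewrite (@conv_extend _ _ g f) // gf //; exact: valP.
- by rewrite -ee efg //; exact: valP.
- by left=> c Dc; have := f0 (exist _ c Dc).
- by right=> c Dc; have := g0 (exist _ c Dc).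
Qed.
End PrimitiveForms.

(** * Coordinates on a power of a simple comodule *)

Section PowerCoordinates.
Variables (K : fieldType) (C : coalgebra K) (D : submodClosed C) (S : comodule C).

Lemma sum_neq0 (V : zmodType) n (x : 'I_n -> V) : \sum_k x k != 0 -> exists k, x k != 0.
Proof.
move=> s0; apply: contrapT => N; case/eqP: s0; apply: big1 => k _.
by apply/eqP; apply: contrapT => /negP xk; apply: N; exists k.
Qed.

(** Injections of S into D and projections of D onto S that realise D as a
    finite direct sum of copies of S, all within C. *)
Record power_coordinates n := PowerCoordinates {
  block_in : 'I_n -> {linear S -> C};
  block_out : 'I_n -> {linear C -> S};
  block_in_colinear : forall k, @colinear _ _ S (regular C) (block_in k);
  block_in_sub : forall k s, block_in k s \in D;
  block_out_colinear : forall k, @colinear_on _ _ (regular C) S D (block_out k);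
  block_inK : forall k, cancel (block_in k) (block_out k);
  block_out_sum : forall c, c \in D -> c = \sum_k block_in k (block_out k c) }.

Lemma power_coordinates_exist n : iso_power D S n -> inhabited (power_coordinates n).
Proof.
move=> [F [FC FI FD]]; have [r FK] := linear_left_inverse FI.
have prL k : linear (fun x : comod_pow n S => x k).
  by move=> a x y; rewrite !ffunE.
pose pr k : {linear comod_pow n S -> S} := HB.pack (fun x : comod_pow n S => x k)
  (GRing.isLinear.Build K (comod_pow n S) S *:%R _ (prL k)).
pose pinn k : {linear S -> comod_pow n S} := pow_in k.
have prC k : colinear (pr k).
  move=> x; rewrite -[coact x]/(pow_coact x) /pow_coact linear_sum (bigD1 k) //= big1.
    by rewrite addr0 tmap_comp tmap_id // => m /=; rewrite ffunE eqxx.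
  move=> l /negPf lk; rewrite tmap_comp.
  rewrite (tmap_ext (f' := \0) (g' := idfun)) ?tmap0l // => m /=.
  by rewrite ffunE eq_sym lk.
have piC k : colinear (pinn k) by move=> m; exact: pow_coact_in.
have FKD c : c \in D -> F (r c) = c by move=> /FD[x <-]; rewrite FK.
have rC : @colinear_on _ _ (regular C) (comod_pow n S) D r.
  by move=> c Dc; rewrite -{2}(FKD c Dc) FC tmap_comp tmap_id.
constructor.
apply: (@PowerCoordinates n (fun k => F \o pinn k) (fun k => pr k \o r)) => [k|k s|k|k s|c Dc].
- exact: colinear_comp (piC k) FC.
- by apply/FD; eexists.
- apply: (@colinear_on_comp K C (regular C) (comod_pow n S) S D full r (pr k) rC).
    by move=> m _; exact: in_full.
  by move=> x _; exact: prC.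
- by rewrite /= FK ffunE eqxx.
by rewrite -[LHS]FKD // [r c in LHS]pow_sum linear_sum.
Qed.
End PowerCoordinates.

(** * One simple block of the coradical *)

Section SimpleBlock.
Variables (K : fieldType) (C : coalgebra K) (D : submodClosed C) (S : comodule C).
Variables (n : nat) (X : power_coordinates D S n) (e : {scalar C}).
Hypotheses (subD : subcoalgebra D) (simS : simple_comodule S).
Hypothesis prim : primitive_on D e.

Local Notation RC := (regular C).
Local Notation T := (@colift K C RC).
Local Notation on_D := (@colinear_on K C RC RC D).

Lemma block_in_support (f : {linear C -> C}) c : c \in D -> f c != 0 ->
  exists k s, f (block_in X k s) != 0.
Proof.
move=> Dc; rewrite {1}(block_out_sum X Dc) linear_sum => /sum_neq0[k fk].
by exists k, (block_out X k c).
Qed.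

Lemma colift_neq0 (f : {scalar C}) c : f c != 0 -> T f c != 0.
Proof.
by apply: contraNneq => Tc; rewrite -(@counit_colift K C RC f) Tc linear0.
Qed.

Lemma colift_vanish (f : {scalar C}) c :
  (forall d, d \in D -> f d = 0) -> c \in D -> T f c = 0.
Proof.
move=> f0 Dc; rewrite -(contractl0 (Delta c)).
by apply: contractl_eq_in (subcoalgebra_coactl subD Dc) => d /f0.
Qed.

(** Through one of the embeddings of S in D, the coaction of S is the
    comultiplication of D. *)
Lemma coact_in_block (s : S) : coact s \in tsub full D.
Proof.
have [k _] : exists k : 'I_n, True.
  have [_ [c Dc ec] _] := prim.
  by have [k [s' _]] := block_in_support Dc (colift_neq0 ec); exists k.
rewrite -(block_inK X k s) (block_out_colinear X k (block_in_sub X k s)).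
by apply: tmap_sub (subD (block_in_sub X k s)) => // x _; exact: in_full.
Qed.

(** Both sides are colinear on D, and their counits agree because [e] is
    idempotent. *)
Lemma idempotent_colift c : c \in D -> T e (T e c) = T e c.
Proof.
have [eI _ _] := prim; move: c.
apply: (colinear_on_ext (f := T e \o T e) subD).
- apply: (@colinear_on_comp K C RC RC RC D D); [exact: colift_colinear_on|
    exact: colift_subcoalgebra|exact: colift_colinear_on].
- exact: colift_colinear_on.
- move=> c Dc; rewrite !(@counit_colift K C RC); exact: eI.
Qed.

(** The right subcomodule D.e is a direct summand of D. It contains a copy of S,
    on which some projection of D is an isomorphism, so this copy is itself a
    direct summand of D, cut out by an idempotent below [e]. Primitivity leaves
    only [e], hence D.e is this copy of S. *)
Lemma primitive_embedding : exists j : {linear S -> C},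
  [/\ @colinear _ _ S RC j, injective j, forall s, j s \in D,
      forall s, T e (j s) = j s & forall c, c \in D -> exists s, T e c = j s].
Proof.
have [eI [c0 Dc0 ec0] eP] := prim.
have [k [s0 Tes0]] := block_in_support Dc0 (colift_neq0 ec0).
pose j : {linear S -> C} := T e \o block_in X k.
have jC : @colinear _ _ S RC j.
  refine (@colinear_comp K C S RC RC (block_in X k) (T e) (block_in_colinear X k) _).
  exact (@colift_colinear K C RC e).
have jI : injective j by exact: (@simple_inj K C S RC j s0 simS jC Tes0).
have jD s : j s \in D by apply: colift_subcoalgebra => //; exact: block_in_sub.
have Tj s : T e (j s) = j s by apply: idempotent_colift; exact: block_in_sub.
exists j; split=> //.
have [l lj0] : exists l, block_out X l (j s0) != 0.
  have /sum_neq0[l jl] : \sum_l block_in X l (block_out X l (j s0)) != 0.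
    by rewrite -(block_out_sum X (jD s0)).
  by exists l; apply: contraNneq jl => ->; rewrite linear0.
pose q : {linear S -> S} := block_out X l \o j.
have qC : colinear q.
  have jCf : @colinear_on K C S RC full j by move=> s _; exact: jC.
  move=> s.
  exact: (@colinear_on_comp K C S RC S full D j (block_out X l) jCf (fun s _ => jD s)
    (block_out_colinear X l) s (in_full s)).
have [a [aC qK aK]] := schur simS qC lj0.
(* The idempotent endomorphism of D with image j(S) that factors through D.e. *)
pose P : {linear C -> C} := j \o (a \o (block_out X l \o T e)).
have TeC : on_D (T e) by exact: colift_colinear_on.
have TD f c (Dc : c \in D) : T f c \in D by exact: colift_subcoalgebra.
have PC : on_D P.
  apply: (@colinear_on_comp K C RC S RC D full).
  - apply: (@colinear_on_comp K C RC S S D full).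
    + by apply: (@colinear_on_comp K C RC RC S D D) => //; [exact: TD|exact: block_out_colinear].
    + by move=> m _; exact: in_full.
    + by move=> m _; exact: aC.
  - by move=> m _; exact: in_full.
  - by move=> m _; exact: jC.
pose f : {scalar C} := counit \o P.
have fE c : f c = counit (P c) by [].
have TfE c : c \in D -> T f c = P c by move=> Dc; exact: (@coliftE K C RC P c (PC c Dc)).
have PE c : P c = j (a (block_out X l (T e c))) by [].
have PTe c : c \in D -> P (T e c) = P c by move=> Dc; rewrite PE idempotent_colift.
have TeP c : T e (P c) = P c by exact: Tj.
have Pj s : P (j s) = j s by rewrite PE Tj -[block_out X l (j s)]/(q s) qK.
have PP c : P (P c) = P c by exact: Pj.
have cT g c : counit (T g c) = g c by exact: (@counit_colift K C RC).
(* The complementary idempotent, which primitivity kills. *)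
pose g : {scalar C} := e \- f.
have ePf c : e (P c) = f c by rewrite -cT TeP.
have eTf c : c \in D -> e (T f c) = f c by move=> Dc; rewrite TfE.
have fTe c : c \in D -> f (T e c) = f c by move=> Dc; rewrite !fE PTe.
have fTf c : c \in D -> f (T f c) = f c by move=> Dc; rewrite TfE // !fE PP.
have gE c : g c = e c - f c by [].
have TgE c : T g c = T e c - T f c.
  apply/eqP; rewrite eq_sym subr_eq; apply/eqP; rewrite -[T g c]scale1r.
  by apply: contractl_lin => d; rewrite gE mul1r subrK.
have gTf c : c \in D -> g (T f c) = 0.
  by move=> Dc; rewrite gE eTf // fTf // subrr.
have fTg c : c \in D -> f (T g c) = 0.
  by move=> Dc; rewrite TgE linearB fTe // fTf // subrr.
have gTg c : c \in D -> g (T g c) = g c.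
  by move=> Dc; rewrite TgE linearB gTf // subr0 (gE (T e c)) (eI c) // fTe.
have efg c : c \in D -> e c = f c + g c by move=> _; rewrite gE addrC subrK.
have [f0|g0] := eP f g fTf gTg gTf fTg efg.
- case/eqP: Tes0; apply: (etrans (esym (Pj s0))).
  rewrite -(TfE _ (jD s0)).
  exact: (colift_vanish f0 (jD s0)).
- move=> c Dc; exists (a (block_out X l (T e c))).
  by have /eqP := colift_vanish g0 Dc; rewrite TgE TfE // subr_eq0 => /eqP.
Qed.

Lemma form_colift_comm (f g : {scalar C}) c : f (dual_act RC g c) = g (T f c).
Proof. exact: contract_comm. Qed.

(** The element [e] acts non-trivially on S, since S embeds in D as a summand
    and [e] does not vanish on D. *)
Lemma fixed_vector_exists : exists2 u : S, u != 0 & dual_act S e u = u.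
Proof.
have [eI [c0 Dc0 ec0] _] := prim.
have [k [s es]] : exists k s, e (block_in X k s) != 0.
  move: ec0; rewrite {1}(block_out_sum X Dc0) linear_sum => /sum_neq0[k fk].
  by exists k, (block_out X k c0).
exists (dual_act S e s).
  apply: contraNneq es => es0.
  have cT : T counit (block_in X k s) = block_in X k s by exact: Delta_counitl.
  rewrite -cT -form_colift_comm.
  have <- := @dual_act_colinear K C S RC e (block_in X k) (block_in_colinear X k) s.
  by rewrite es0 !linear0.
rewrite dual_actM; apply: contractr_eq_in (coact_in_block s) => c Dc.
by rewrite -(eI c Dc) -form_colift_comm.
Qed.

(** Candidates for [phi] are forced: phi (f.u) = f.m. This is well defined as
    soon as f.u = 0 implies f.m = 0, and [f] may be replaced by f * e. If f * e
    does not vanish on D, it gives a nonzero comodule map from D to D.e, which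
    is simple by [primitive_embedding]; a section of that map yields g with g *
    f * e = e on D, and then u = e.u = g.(f.u) = 0. *)
Lemma evaluation_surj (M : comodule C) (u : S) (m : M) :
  u != 0 -> dual_act S e u = u -> coact m \in tsub full D -> dual_act M e m = m ->
  exists2 phi : {linear S -> M}, colinear phi & phi u = m.
Proof.
move=> u0 eu mD em; have [j [jC jI jD Tj Dj]] := primitive_embedding.
have [jr jK] := linear_left_inverse jI.
have killed f : dual_act S f u = 0 -> dual_act M f m = 0.
  move=> fu; pose f' : {scalar C} := f \o dual_act RC e.
  have f'u : dual_act S f' u = 0 by rewrite -fu -{2}eu dual_actM.
  have -> : dual_act M f m = dual_act M f' m by rewrite -{1}em dual_actM.
  have [f'0|] := pselect (forall c, c \in D -> f' c = 0).
    rewrite -(contractr0 (coact m)).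
    by apply: contractr_eq_in mD => d /f'0.
  move=> /existsNP[c0 /not_implyP[Dc0 /eqP f'c0]].
  have [k [s0 fs0]] := block_in_support Dc0 (colift_neq0 f'c0).
  have Tf'E d : d \in D -> T f' d = T e (T f d).
    move: d; apply: (colinear_on_ext (g := T e \o T f) subD).
    - exact: colift_colinear_on.
    - apply: (@colinear_on_comp K C RC RC RC D D); [exact: colift_colinear_on|
        exact: colift_subcoalgebra|exact: colift_colinear_on].
    - by move=> d Dd; rewrite !(@counit_colift K C RC) /= form_colift_comm.
  have f'De d : d \in D -> j (jr (T f' d)) = T f' d.
    move=> Dd; rewrite Tf'E //.
    by have [s ->] := Dj _ (colift_subcoalgebra subD f Dd); rewrite jK.
  have eDe d : d \in D -> j (jr (T e d)) = T e d.
    by move=> Dd; have [s ->] := Dj _ Dd; rewrite jK.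
  pose b : {linear S -> S} := jr \o (T f' \o block_in X k).
  have bC : colinear b.
    have pC s : s \in (full : submodClosed S) ->
        @coact _ _ RC ((T f' \o block_in X k) s) = tmap (T f' \o block_in X k) idfun (coact s).
      move=> _; refine (@colinear_comp K C S RC RC (block_in X k) (T f')
        (block_in_colinear X k) _ s).
      exact (@colift_colinear K C RC f').
    move=> s; apply: (@colinear_corestrict K C S S RC full (T f' \o block_in X k) j jr jC jK pC).
      by move=> s' _; apply: f'De; exact: block_in_sub.
    exact: in_full.
  have bs0 : b s0 != 0.
    apply: contraNneq fs0 => bs.
    by rewrite -(f'De _ (block_in_sub X k s0)) -[jr _]/(b s0) bs linear0.
  (* c inverts T f' between a summand S of D and D.e, so G is a section of T f'. *)
  have [c [cC bK cK]] := schur simS bC bs0.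
  pose G : {linear C -> C} := block_in X k \o (c \o (jr \o T e)).
  have jrC : @colinear_on K C RC S D (jr \o T e).
    apply: (@colinear_corestrict K C RC S RC D (T e) j jr jC jK) => //.
    exact: colift_colinear_on.
  have GC : on_D G.
    apply: (@colinear_on_comp K C RC S RC D full (c \o (jr \o T e)) (block_in X k)).
    - apply: (@colinear_on_comp K C RC S S D full (jr \o T e) c jrC) => [d _|s _].
        exact: in_full.
      exact: cC.
    - by move=> d _; exact: in_full.
    - by move=> s _; exact: block_in_colinear.
  have GE d : d \in D -> f' (G d) = e d.
    move=> Dd; rewrite -(@counit_colift K C RC f') -f'De ?(block_in_sub X k) //.
    rewrite -[jr _]/(b (c (jr (T e d)))) cK eDe //.
    exact: (@counit_colift K C RC e).
  case/eqP: u0; rewrite -eu.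
  pose g : {scalar C} := counit \o G.
  have -> : dual_act S e u = dual_act S g (dual_act S f' u); last by rewrite f'u linear0.
  rewrite dual_actM; apply: contractr_eq_in (coact_in_block u) => d Dd.
  apply: etrans (esym (GE d Dd)) _.
  rewrite -[G d](@coliftE K C RC G d (GC d Dd)).
  exact: esym (form_colift_comm g f' d).
have /choice[th thP] := dual_act_generates simS u0.
have thE f s : dual_act S f u = s -> dual_act M f m = dual_act M (th s) m.
  move=> fs; apply/eqP; rewrite -subr_eq0; apply/eqP.
  have <- : dual_act M (f \- th s) m = dual_act M f m - dual_act M (th s) m.
    apply/eqP; rewrite eq_sym subr_eq -[dual_act M (f \- th s) m]scale1r; apply/eqP.
    by apply: dual_act_lin => c /=; rewrite mul1r subrK.
  apply: killed.
  have /eqP : dual_act S f u = 1 *: dual_act S (f \- th s) u + dual_act S (th s) u.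
    by apply: dual_act_lin => c /=; rewrite mul1r subrK.
  by rewrite fs thP scale1r -subr_eq subrr eq_sym => /eqP.
pose ph s := dual_act M (th s) m.
have phL : linear ph.
  move=> a x y.
  have hL : scalar (fun c => a * th x c + th y c).
    move=> k c d; rewrite !linearP !mulrDr addrACA; congr (_ + _).
    by rewrite mulrCA.
  pose h : {scalar C} := HB.pack (fun c => a * th x c + th y c)
    (GRing.isLinear.Build K C K *%R _ hL).
  rewrite /ph -(thE h); last by rewrite (@dual_act_lin _ _ _ (th x) (th y) h a) // !thP.
  by rewrite (@dual_act_lin _ _ _ (th x) (th y) h a).
pose phi : {linear S -> M} := HB.pack ph (GRing.isLinear.Build K S M *:%R _ phL).
have phiE f : phi (dual_act S f u) = dual_act M f m by exact/esym/thE.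
exists phi; last by rewrite -{1}eu phiE.
move=> s; rewrite -(thP s) phiE !coact_dual_act.
have cu : tmap phi idfun (coact u) = coact m.
  by apply: tensor_extr => f; rewrite contractr_nat; exact: phiE.
rewrite -cu !tmap_comp.
by apply: tmap_ext.
Qed.
End SimpleBlock.

(** * The bicomodule C / C_0 *)

Section CoradicalQuotient.
Variables (K : fieldType) (C : coalgebra K).
Local Notation RC := (regular C).
Local Notation C0 := (coradical C).
Local Notation pi := (qproj C0).
Local Notation T := (@colift K C RC).

Lemma coradical_subcomodule : @subcomodule K C RC C0.
Proof. by move=> c; exact: (subcoalgebra_coactl (@subcoalgebra_coradical _ _)). Qed.

Definition corad_quo : comodule C := quo_comodule coradical_subcomodule.
Local Notation Q := corad_quo.

Lemma pi_colinear : @colinear _ _ RC Q pi.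
Proof. exact: quo_coactE. Qed.

Lemma rho_lE c : rho_l C (pi c) = tmap idfun pi (Delta c).
Proof. exact (quo_liftE (@Delta_pi0 K C) c). Qed.

Lemma rho_rE (m : Q) : rho_r C m = coact m.
Proof.
have [c <-] := pi_surj m; apply: etrans (esym (pi_colinear c)).
exact (quo_liftE (@pi_Delta0 K C) c).
Qed.

(** The action of [f] on C / C_0 induced by translation; when [f] extends a
    functional on D and the left coaction of m has its first factor in D, this
    is the right action m . f of the dual algebra of D. *)
Definition quo_colift (f : {scalar C}) : {linear Q -> Q} := contractl f \o rho_l C.

Lemma quo_colift_pi f c : quo_colift f (pi c) = pi (T f c).
Proof. by rewrite -[LHS]/(contractl f _) rho_lE contractl_nat. Qed.

Lemma quo_colift_colinear f : colinear (quo_colift f).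
Proof.
move=> m; have [c <-] := pi_surj m.
rewrite quo_colift_pi !pi_colinear (@colift_colinear K C RC f c) !tmap_comp.
by apply: tmap_ext => // x /=; rewrite -quo_colift_pi.
Qed.

Lemma rho_l_quo_colift f (m : Q) : rho_l C (quo_colift f m) = tmap (T f) idfun (rho_l C m).
Proof.
have [c <-] := pi_surj m.
rewrite quo_colift_pi !rho_lE (@colift_colinear K C RC f c) !tmap_comp.
by apply: tmap_ext.
Qed.

Lemma rho_l_dual_act f (m : Q) : rho_l C (dual_act Q f m) = tmap idfun (dual_act Q f) (rho_l C m).
Proof.
have [c <-] := pi_surj m.
rewrite -(dual_act_colinear f pi_colinear) !rho_lE (@coact_dual_act K C RC f c) !tmap_comp.
by apply: tmap_ext => // x; exact: dual_act_colinear pi_colinear x.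
Qed.

Lemma corad_filt1P c : (c \in corad_filt C 1) <->
  (Delta c \in addsp (tsub full C0) (tsub C0 full)).
Proof. by split=> [/subspace_ofP|Dc] //; apply/subspace_ofP. Qed.

Lemma tsub_ker (V W : lmodType K) (U : submodClosed V) (t : (V ⊗ W)%type) :
  tmap (qproj U) idfun t = 0 -> t \in tsub U full.
Proof.
move=> t0; apply: tsub_contractr => g; rewrite -pi_eq0 -contractr_nat t0.
by rewrite linear0.
Qed.

(** The part of C / C_0 whose right coaction has its second factor in C_0 lies
    in C_1 / C_0: correct the comultiplication of a representative by its
    projection to C (x) C_0; what is left dies modulo C_0 in the first factor,
    hence lies in C_0 (x) C. *)
Lemma C1C0_of_coact (m : Q) : coact m \in tsub full C0 -> m \in C1C0 C.
Proof.
have [c <-] := pi_surj m; rewrite pi_colinear => cC0.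
apply/subspace_ofP; exists c => //; apply/corad_filt1P/subspace_ofP.
pose p := tmap idfun (projector C0) (Delta c).
have pE : tmap pi idfun p = tmap pi idfun (Delta c).
  transitivity (tmap idfun (projector C0) (tmap pi idfun (Delta c))).
    by rewrite !tmap_comp; apply: tmap_ext.
  rewrite (tmap_eq_in (f' := idfun) (g' := idfun) _ _ cC0) ?tmap_id //.
  exact: projector_id.
exists p, (Delta c - p); split; last by rewrite addrC subrK.
  apply: tmap_sub (in_tsub_full _) => // x _; exact: projector_in.
by apply: tsub_ker; rewrite linearB pE subrr.
Qed.

(** Comodule maps from a semisimple comodule land in the socle of C / C_0. *)
Lemma colinear_C1C0 (S : comodule C) (phi : {linear S -> Q}) s :
  colinear phi -> coact s \in tsub full C0 -> phi s \in C1C0 C.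
Proof.
move=> phiC sC0; apply: C1C0_of_coact; rewrite phiC.
by apply: tmap_sub sC0.
Qed.

Lemma colinear_coradical (S : comodule C) (phi : {linear S -> C}) s :
  @colinear _ _ S RC phi -> coact s \in tsub full C0 -> phi s \in C0.
Proof. by move=> phiC sC0; rewrite -(coliftE (phiC s)); exact: contractl_in. Qed.

Lemma colift_coradical f c : c \in C0 -> T f c \in C0.
Proof. exact: (colift_subcoalgebra (@subcoalgebra_coradical _ _)). Qed.

Lemma rho_l_C1C0l (m : Q) : m \in C1C0 C -> rho_l C m \in tsub C0 full.
Proof.
move=> /subspace_ofP[c /corad_filt1P/subspace_ofP[a [b [aC bC Dc]]] <-].
rewrite rho_lE Dc linearD (tmap_kill (A := full) (B := C0) _ aC) ?add0r.
  by apply: tmap_sub bC => // x _; exact: in_full.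
by move=> x y _ /coradical_pi ->; rewrite linear0r.
Qed.

Lemma quo_colift_C1C0 f (m : Q) : m \in C1C0 C -> quo_colift f m \in C1C0 C.
Proof.
move=> /subspace_ofP[c /corad_filt1P/subspace_ofP[a [b [aC bC Dc]]] <-].
rewrite quo_colift_pi; apply/subspace_ofP; exists (T f c) => //.
apply/corad_filt1P/subspace_ofP; exists (tmap (T f) idfun a), (tmap (T f) idfun b).
split.
- by apply: tmap_sub aC => // x _; exact: in_full.
- by apply: tmap_sub bC => // x; exact: colift_coradical.
- by rewrite -linearD -Dc; exact: (@colift_colinear K C RC f c).
Qed.

Lemma rho_l_C1C0r (m : Q) : m \in C1C0 C -> rho_l C m \in tsub full (C1C0 C).
Proof. by move=> mC; apply: tsub_contractl => f; exact: quo_colift_C1C0. Qed.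

(** On C_1 / C_0 the left coaction has its first factor in C_0, so only the
    restriction of a functional to C_0 acts. *)
Lemma quo_colift_eq_in (f g : {scalar C}) (m : Q) :
  (forall c, c \in C0 -> f c = g c) -> m \in C1C0 C -> quo_colift f m = quo_colift g m.
Proof. by move=> fg mC; apply: contractl_eq_in (rho_l_C1C0l mC) => c /fg. Qed.
End CoradicalQuotient.

(** * From comodule maps to the Gabriel space *)

Section Evaluation.
Variables (K : fieldType) (C : coalgebra K).
Local Notation RC := (regular C).
Local Notation C0 := (coradical C).
Local Notation pi := (qproj C0).
Local Notation T := (@colift K C RC).
Local Notation Q := (corad_quo C).

Fact fixed_hom_closed (S : comodule C) (f : {scalar C}) : subsemimod_closed
  (asPred (fun phi : S -> Q => phi \in HomC S Q /\ forall s, quo_colift f (phi s) = phi s)).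
Proof.
apply: closedPP => [|p q [pC pf] [qC qf]|a p [pC pf]].
- by split=> [|s]; [exact: (rpred0 (HomC _ _))|exact: linear0].
- by split=> [|s]; [exact: rpredD|rewrite -[(p + q) s]/(p s + q s) linearD pf qf].
- by split=> [|s]; [exact: rpredZ|rewrite -[(a *: p) s]/(a *: p s) linearZ_LR pf].
Qed.
(** Comodule maps from S to C / C_0 with values fixed by the action of [f]; for
    [f] idempotent on C_0 this is Hom_C(S, (C_1 / C_0) . f) when S is simple.
    Both sides of the theorem are computed by this space. *)
Definition fixed_hom S f := subspace_of (@fixed_hom_closed S f).

Lemma fixed_homP (S : comodule C) f (phi : S -> Q) : phi \in fixed_hom S f <->
  exists2 g : {linear S -> Q}, colinear g /\ (forall s, quo_colift f (g s) = g s) & phi = g.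
Proof.
split=> [/subspace_ofP[/subspace_ofP[g gC ->] gf]|[g [gC gf] ->]]; first by exists g.
by apply/subspace_ofP; split=> //; apply/subspace_ofP; exists g.
Qed.

Variables (Di Dj : submodClosed C) (S : comodule C) (n : nat).
Variables (ei : {scalar sub Di}) (ej : {scalar sub Dj}) (fi fj : {scalar C}).
Hypotheses (fiE : forall d, fi (val d) = ei d) (fjE : forall d, fj (val d) = ej d).
Hypotheses (subDi : subcoalgebra Di) (DiC0 : {subset Di <= C0}).
Hypotheses (X : power_coordinates Di S n) (simS : simple_comodule S).
Hypotheses (primi : primitive_on Di fi) (idemj : idempotent_on Dj fj).
Hypothesis (TfjC0 : forall c, c \in C0 -> T fj c \in Dj).

Lemma act_l_dual_act (m : Q) : coact m \in tsub full Di -> act_l ei m = dual_act Q fi m.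
Proof.
move=> mDi.
have -> : act_l ei m = contractr ei (tmap idfun (retr Di) (rho_r C m)) by [].
rewrite contractr_tmap rho_rE; apply: contractr_eq_in mDi => d Dd.
exact: etrans (congr1 ei (retrK (exist (fun x => x \in Di) d Dd))) (esym (fiE _)).
Qed.

Lemma act_r_quo_colift (m : Q) : rho_l C m \in tsub Dj full -> act_r ej m = quo_colift fj m.
Proof.
move=> mDj.
have -> : act_r ej m = contractl ej (tmap (retr Dj) idfun (rho_l C m)) by [].
rewrite contractl_tmap; apply: contractl_eq_in mDj => d Dd.
exact: etrans (congr1 ej (retrK (exist (fun x => x \in Dj) d Dd))) (esym (fjE _)).
Qed.

Section FixedHom.
Variable phi : {linear S -> Q}.
Hypotheses (phiC : colinear phi) (phif : forall s, quo_colift fj (phi s) = phi s).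

Lemma colinear_support s : coact (phi s) \in tsub full Di.
Proof.
by rewrite phiC; apply: tmap_sub (coact_in_block X subDi primi s) => // x _.
Qed.

Lemma coact_in_coradical (s : S) : coact s \in tsub full C0.
Proof. by apply: tsub_mono (coact_in_block X subDi primi s). Qed.

Let phiC1 s : phi s \in C1C0 C := colinear_C1C0 phiC (coact_in_coradical s).

(** The right support is that of S. The left support lies in C_0 because S maps
    to C_1 / C_0, and then in D_j because the values are fixed by a translation
    that sends C_0 into D_j. *)
Lemma fixed_hom_bipart s : phi s \in bipart Dj Di.
Proof.
apply/subspace_ofP; split; first exact: phiC1.
  apply: tsub_meet; last exact: rho_l_C1C0r (phiC1 s).
  rewrite -phif rho_l_quo_colift.
  by apply: tmap_sub (rho_l_C1C0l (phiC1 s)) => c; [exact: TfjC0|].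
by rewrite rho_rE phiC; apply: tmap_sub (coact_in_block X subDi primi s).
Qed.
End FixedHom.

Variables (u : S) (u0 : u != 0) (fiu : dual_act S fi u = u).

Lemma fixed_hom_gabriel (phi : S -> Q) :
  phi \in fixed_hom S fj -> phi u \in gabriel_space ei ej.
Proof.
move=> /fixed_homP[g [gC gf] ->]; apply/subspace_ofP; exists (g u).
  exact: fixed_hom_bipart.
have /subspace_ofP[_ mj _] := fixed_hom_bipart gC gf u.
rewrite -[LHS]/(act_r ej (act_l ei (g u))) act_l_dual_act; last exact: colinear_support.
rewrite -(dual_act_colinear fi gC) fiu act_r_quo_colift ?gf //.
by apply: tsub_mono mj => // x _; exact: in_full.
Qed.

Definition eval_fixed (phi : sub (fixed_hom S fj)) : sub (gabriel_space ei ej) :=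
  exist _ (val phi u) (fixed_hom_gabriel (valP phi)).

Fact eval_fixed_linear : linear eval_fixed.
Proof. by move=> a x y; apply: val_inj. Qed.
HB.instance Definition _ := GRing.isLinear.Build K (sub (fixed_hom S fj))
  (sub (gabriel_space ei ej)) *:%R eval_fixed eval_fixed_linear.

(** The two idempotents act by commuting operators on the bicomodule, so their
    product fixes its own image. *)
Lemma gabriel_fixed (m : Q) : m \in gabriel_space ei ej ->
  [/\ coact m \in tsub full Di, dual_act Q fi m = m & quo_colift fj m = m].
Proof.
move=> /subspace_ofP[x /subspace_ofP[xC1 xj xi] xm].
have {xi} xi : @coact _ _ Q x \in tsub full Di.
  by rewrite -rho_rE; apply: tsub_mono xi => // y _; exact: in_full.
have [fiI _ _] := primi.
have hDi d : d \in Di -> dual_act RC fi d \in Di.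
  by move=> Dd; apply: contractr_in; exact: subcoalgebra_coactl.
pose y := dual_act Q fi x.
have yi : coact y \in tsub full Di.
  by rewrite coact_dual_act; apply: tmap_sub xi.
have yj : rho_l C y \in tsub Dj full.
  rewrite rho_l_dual_act; apply: tmap_sub xj => // z _; exact: in_full.
have hy : dual_act Q fi y = y.
  rewrite /y dual_actM; apply: contractr_eq_in xi => d Dd.
  by rewrite -[RHS]fiI // -form_colift_comm.
have -> : m = quo_colift fj y.
  rewrite -xm.
  by rewrite -[LHS]/(act_r ej (act_l ei x)) act_l_dual_act // act_r_quo_colift.
split.
- rewrite quo_colift_colinear; apply: tmap_sub yi => // z _; exact: in_full.
- by rewrite -(dual_act_colinear fi (quo_colift_colinear fj)) hy.
- rewrite -[LHS]/(contractl fj _) rho_l_quo_colift contractl_tmap.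
  by apply: contractl_eq_in yj => d /idemj.
Qed.

(** A comodule map out of a simple comodule is determined by its value at [u];
    conversely [evaluation_surj] gives a comodule map with any prescribed value
    fixed by e_i, and it is fixed by [fj] because its value at [u] is. *)
Lemma eval_fixed_bij : bijective eval_fixed.
Proof.
apply: linear_bij => [p q pq|m].
  have /fixed_homP[g [gC gf] gE] := valP (p - q).
  have gu : g u = 0.
    have pqu : val p u = val q u by exact: (congr1 val pq).
    rewrite -gE; transitivity (val p u - val q u) => //.
    by rewrite pqu subrr.
  apply/eqP; rewrite -subr_eq0; apply/eqP/val_inj; rewrite gE; apply/funext => s.
  exact: simple_vanish gu s.
have [mDi him fjm] := gabriel_fixed (valP m).
have [phi phiC phiu] := evaluation_surj X subDi simS primi u0 fiu mDi him.
have phif s : quo_colift fj (phi s) = phi s.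
  apply/eqP; rewrite -subr_eq0; apply/eqP.
  have dC := colinear_sub (colinear_comp phiC (quo_colift_colinear fj)) phiC.
  apply: (simple_vanish simS dC u0).
  by rewrite -[LHS]/(quo_colift fj (phi u) - phi u) phiu fjm subrr.
have phiF : (phi : S -> Q) \in fixed_hom S fj by apply/fixed_homP; exists phi.
by exists (exist (fun p => p \in fixed_hom S fj) _ phiF); apply: val_inj.
Qed.
End Evaluation.

(** * From comodule maps to Ext *)

Section Connecting.
Variables (K : fieldType) (C : coalgebra K).
Local Notation RC := (regular C).
Local Notation C0 := (coradical C).
Local Notation pi := (qproj C0).
Local Notation T := (@colift K C RC).
Local Notation Q := (corad_quo C).

Variables (N S : comodule C) (R : injective_resolution N).
Variables (j : {linear N -> C}) (f : {scalar C}).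
Hypotheses (jC : @colinear _ _ N RC j) (jI : injective j) (jC0 : forall x, j x \in C0).
Hypotheses (Tfj : forall x, T f (j x) = j x).
Hypothesis (TfC0 : forall c, c \in C0 -> exists x, T f c = j x).
Hypothesis (SC0 : forall s : S, coact s \in tsub full C0).

Local Notation eta := (res_aug R).
Local Notation d0 := (res_d R 0).
Local Notation d1 := (res_d R 1).

(** Cofreeness of C makes it injective: it is enough to extend the functional
    counit o j along the augmentation. *)
Lemma regular_extension : exists2 k : {linear res R 0 -> C},
  @colinear _ _ (res R 0) RC k & forall x, k (eta x) = j x.
Proof.
have [s sK] := linear_left_inverse (@res_aug_inj _ _ _ R).
pose phi : {scalar res R 0} := counit \o (j \o s).
exists (colift phi); first exact: colift_colinear.
move=> x; rewrite -[LHS]/(contractl phi _) res_aug_colinear contractl_tmap.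
rewrite -[RHS](coliftE (jC x)); apply: contractl_eq_in (in_tsub_full _) => y _.
by rewrite /= sK.
Qed.

Lemma augmentation_extension : exists2 h : {linear C -> res R 0},
  @colinear _ _ RC (res R 0) h & forall x, h (j x) = eta x.
Proof.
have [h hC hj] := @res_inj _ _ _ R 0 N RC j eta jC jI (@res_aug_colinear _ _ _ R).
by exists h.
Qed.

(** Let h : C -> R^0 extend the augmentation along [j] and let T be translation
    by [f]. As T maps C_0 into j(N), the map d h T kills C_0 and induces a
    connecting map del : C / C_0 -> R^1; a map phi : S -> C / C_0 goes to the
    class of del o phi. Injectivity and surjectivity use k : R^0 -> C with k o
    eta = j. The composite k h T agrees with T on C_0, hence acts as T does on
    C_1 / C_0; this recovers phi from a lift of del o phi. Conversely a cocycle
    g = d x gives psi = pi k x, and x - h T k x corrects del o psi to g. *)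
Lemma fixed_hom_Ext1 :
  exists F : {linear sub (fixed_hom S f) -> Ext1 S R}, bijective F.
Proof.
have [k kC keta] := regular_extension.
have [h hC hj] := augmentation_extension.
have TC : @colinear _ _ RC RC (T f) by exact: (@colift_colinear K C RC f).
have d0C := @res_d_colinear _ _ _ R 0.
have d0eta x : d0 (eta x) = 0 by apply/res_exact0; exists x.
pose b : {linear C -> res R 1} := d0 \o (h \o T f).
have hTC : @colinear _ _ RC (res R 0) (h \o T f).
  exact: (@colinear_comp _ _ RC RC (res R 0) (T f) h TC hC).
have bC : @colinear _ _ RC (res R 1) b.
  exact: (@colinear_comp _ _ RC (res R 0) (res R 1) (h \o T f) d0 hTC d0C).
have idC : @colinear _ _ Q Q idfun by move=> m; rewrite tmap_id.
have [del delC delE] : exists2 del : {linear Q -> res R 1}, colinear del &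
    forall m c, pi c = m -> del m = b c.
  apply: (@colinear_descent _ _ RC Q Q (res R 1) pi idfun b (@pi_colinear _ _) idC bC).
    exact: pi_surj.
  move=> c /eqP; rewrite pi_eq0 => /TfC0[x Tc].
  by rewrite /b /= -[contractl f _]/(T f c) Tc hj d0eta.
have d1del m : d1 (del m) = 0.
  have [c pc] := pi_surj m; rewrite (delE m c pc).
  by apply/res_exact; exists (h (T f c)).
have cocyc (phi : S -> Q) : phi \in fixed_hom S f -> (del \o phi) \in cocycles S R.
  move=> /fixed_homP[g [gC gf] ->]; apply/subspace_ofP; split=> [|s]; last exact: d1del.
  apply/subspace_ofP; exists (del \o g) => //; exact: colinear_comp gC delC.
pose F0 (p : sub (fixed_hom S f)) : sub (cocycles S R) :=
  exist (fun x => x \in cocycles S R) (del \o val p) (cocyc _ (valP p)).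
have F0L : linear F0.
  move=> a x y; apply/val_inj/funext => s.
  exact: (linearP del a (val x s) (val y s)).
pose F0l : {linear sub (fixed_hom S f) -> sub (cocycles S R)} :=
  HB.pack F0 (GRing.isLinear.Build K _ (sub (cocycles S R)) *:%R F0 F0L).
exists (qproj (coboundaries S R) \o F0l); apply: linear_bij => [p q /eqP pq|y].
  have {pq} : F0l (p - q) \in coboundaries S R.
    by rewrite -pi_eq0 !linearB /= subr_eq0.
  move=> /subspace_ofP[_ /subspace_ofP[g gC ->] dg].
  apply/eqP; rewrite -subr_eq0; apply/eqP.
  have /fixed_homP[G [GC Gf] GE] := valP (p - q).
  apply: val_inj; rewrite GE; apply/funext => s.
  have [c pc] := pi_surj (G s).
  have [x xE] : exists x, eta x = h (T f c) - g s.
    have dgs : del (G s) = d0 (g s).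
      apply: etrans (congr1 (fun F => F s) dg).
      exact: esym (congr1 (fun F => del (F s)) GE).
    apply/res_exact0; rewrite linearB -dgs (delE _ _ pc); exact: subrr.
  have kgC0 : k (g s) \in C0.
    have kgC := @colinear_comp _ _ S (res R 0) RC g k gC kC.
    exact: (colinear_coradical kgC (SC0 s)).
  (* k h T c represents G s modulo C_0, as k h T and T act alike on C_1 / C_0. *)
  have khTC0 : k (h (T f c)) \in C0.
    have -> : k (h (T f c)) = j x + k (g s) by rewrite -keta xE linearB subrK.
    by apply: rpredD.
  pose f' : {scalar C} := counit \o (k \o (h \o T f)).
  have khTC := @colinear_comp _ _ RC (res R 0) RC (h \o T f) k hTC kC.
  have Tf' : T f' c = k (h (T f c)) by exact: (@coliftE K C RC _ c (khTC c)).
  rewrite -Gf (@quo_colift_eq_in _ _ f f') ?colinear_C1C0 //.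
    by rewrite -pc quo_colift_pi Tf'; apply/eqP; rewrite pi_eq0.
  move=> e /TfC0[z Tz]; rewrite -[RHS]/(counit (k (h (T f e)))) Tz hj keta -Tz.
  by rewrite (@counit_colift K C RC).
have [z <-] := pi_surj y.
have /subspace_ofP[/subspace_ofP[g gC gE] gd] := valP z.
have gS s : exists x, d0 x = g s by apply/res_exact; rewrite -gE.
have d0K x : d0 x = 0 -> exists n, eta n = x by move/res_exact0.
have pkC : colinear (pi \o k : {linear res R 0 -> Q}).
  exact: (@colinear_comp _ _ (res R 0) RC Q k pi kC (@pi_colinear _ _)).
have [psi psiC psiE] : exists2 psi : {linear S -> Q}, colinear psi &
    forall s x, d0 x = g s -> psi s = pi (k x).
  apply: (colinear_descent d0C gC pkC gS) => x /d0K[n <-].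
  by apply/eqP; rewrite /= keta pi_eq0.
have TkC := @colinear_comp _ _ (res R 0) RC RC k (T f) kC TC.
have hTkC := @colinear_comp _ _ (res R 0) RC (res R 0) (T f \o k) h TkC hC.
have id0C : @colinear _ _ (res R 0) (res R 0) idfun by move=> m; rewrite tmap_id.
(* Its values lie in C_0, which makes psi fixed by f. *)
have [bet betC betE] : exists2 bet : {linear S -> C}, @colinear _ _ S RC bet &
    forall s x, d0 x = g s -> bet s = k x - T f (k x).
  apply: (@colinear_descent _ _ (res R 0) (res R 1) S RC d0 g (k \- (T f \o k))) => //.
    exact: (@colinear_sub _ _ (res R 0) RC k (T f \o k) kC TkC).
  move=> x /d0K[n <-]; rewrite -[LHS]/(k (eta n) - T f (k (eta n))).
  by rewrite keta Tfj subrr.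
(* The cochain whose boundary is the difference of the cocycles g and del o psi. *)
have [gam gamC gamE] : exists2 gam : {linear S -> res R 0}, colinear gam &
    forall s x, d0 x = g s -> gam s = x - h (T f (k x)).
  apply: (@colinear_descent _ _ (res R 0) (res R 1) S (res R 0) d0 g
    (idfun \- (h \o (T f \o k)))) => //.
    exact: (colinear_sub id0C hTkC).
  move=> x /d0K[n <-]; rewrite -[LHS]/(eta n - h (T f (k (eta n)))).
  by rewrite keta Tfj hj subrr.
have psif s : quo_colift f (psi s) = psi s.
  have [x dx] := gS s; rewrite (psiE s x dx) quo_colift_pi; apply/eqP.
  rewrite eq_sym -subr_eq0 -linearB pi_eq0 -(betE s x dx).
  exact: (colinear_coradical betC (SC0 s)).
have psiF : (psi : S -> Q) \in fixed_hom S f by apply/fixed_homP; exists psi.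
exists (exist (fun p => p \in fixed_hom S f) _ psiF).
apply/eqP; rewrite eq_sym -subr_eq0 -linearB pi_eq0; apply/subspace_ofP.
exists gam; first by apply/subspace_ofP; exists gam.
apply/funext => s; have [x dx] := gS s.
rewrite -[LHS]/(val z s - del (psi s)) gE -[g _]/(g s) (delE _ (k x)) ?(psiE s x) //.
by rewrite /= (gamE s x) // linearB dx.
Qed.
End Connecting.

(** * Extending a functional by zero off one summand *)

Section OtherSummands.
Variables (K : fieldType) (V : lmodType K) (I : choiceType).
Variables (U : submodClosed V) (D : I -> submodClosed V) (j : I).
Hypothesis dsum : direct_sum U D.

(** The condition [d j = 0] rather than [j \notin s] makes the set visibly
    closed under sums. *)
Fact other_closed : subsemimod_closed (asPred (fun x : V =>
  exists (s : seq I) (d : I -> V),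
    [/\ uniq s, forall i, d i \in D i, d j = 0 & x = \sum_(i <- s) d i])).
Proof.
have sumE (s s' : seq I) (d : I -> V) : uniq s -> uniq s' -> {subset s <= s'} ->
    \sum_(i <- s') (if i \in s then d i else 0) = \sum_(i <- s) d i.
  move=> us us' ss; rewrite -big_mkcond /= -big_filter; apply: perm_big.
  apply: uniq_perm; rewrite ?filter_uniq // => i; rewrite mem_filter.
  by case: (boolP (i \in s)) => // /ss.
apply: closedPP => [|_ _ [s [d [us dD dj ->]]] [s' [d' [us' dD' dj' ->]]]
  |a _ [s [d [us dD dj ->]]]].
- exists [::], (fun=> 0); rewrite big_nil; split=> // i; exact: (rpred0 (D i)).
- pose t := undup (s ++ s').
  exists t, (fun i => (if i \in s then d i else 0) + (if i \in s' then d' i else 0)).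
  split; first exact: undup_uniq.
  + by move=> i; apply: rpredD; case: ifP => // _; exact: (rpred0 (D i)).
  + by rewrite dj dj' !if_same addr0.
  + rewrite big_split /= !sumE ?undup_uniq // => i iss.
      by rewrite mem_undup mem_cat iss orbT.
    by rewrite mem_undup mem_cat iss.
- exists s, (fun i => a *: d i); rewrite scaler_sumr dj scaler0; split=> // i.
  exact: rpredZ.
Qed.
Definition other_summands := subspace_of other_closed.

Lemma other_summands_in k x : k != j -> x \in D k -> x \in other_summands.
Proof.
move=> kj xk; apply/subspace_ofP.
exists [:: k], (fun i => if i == k then x else 0).
rewrite big_seq1 eqxx eq_sym (negPf kj); split=> // i.
by have [->|_] := eqVneq i k; last exact: (rpred0 (D i)).
Qed.

(** From x = sum d_i with d_j = 0, put - x in position j: directness forces x =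
    0. *)
Lemma other_summands_meet x : x \in D j -> x \in other_summands -> x = 0.
Proof.
move=> xj /subspace_ofP[s [d [us dD dj xE]]].
pose d' i := if i == j then - x else d i.
have dD' i : d' i \in D i.
  rewrite /d'; have [->|_] := eqVneq i j; last exact: dD.
  by rewrite -scaleN1r; apply: rpredZ.
have sumj (r : seq I) : j \notin r -> \sum_(i <- r) d' i = \sum_(i <- r) d i.
  move=> jr; apply: eq_big_seq => i ir; rewrite /d'.
  by have [ij|//] := eqVneq i j; rewrite -ij ir in jr.
have dj0 : d' j = 0.
  have [js|js] := boolP (j \in s).
    apply: (dsum.2 s d' us dD' _ j js).
    rewrite (perm_big _ (perm_to_rem js)) big_cons sumj ?mem_rem_uniq ?inE ?eqxx //.
    move: xE; rewrite (perm_big _ (perm_to_rem js)) big_cons /= dj add0r => <-.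
    by rewrite /d' eqxx addNr.
  apply: (dsum.2 (j :: s) d' _ dD' _ j (mem_head _ _)); first by rewrite /= js.
  by rewrite big_cons sumj // -xE /d' eqxx addNr.
by move: dj0; rewrite /d' eqxx => /eqP; rewrite oppr_eq0 => /eqP.
Qed.

(** The summand embeds in the quotient by the sum of the others; a retraction of
    this embedding is composed with [e]. *)
Lemma form_on_summand (e : {scalar sub (D j)}) : exists f : {scalar V},
  (forall d, f (val d) = e d) /\ forall k, k != j -> forall x, x \in D k -> f x = 0.
Proof.
pose p : {linear sub (D j) -> (V ⧸ other_summands)%type} :=
  qproj other_summands \o (\val : {linear sub (D j) -> V}).
have pI : injective p.
  move=> x y /eqP; rewrite -subr_eq0 -linearB => /eqP p0.
  apply/eqP; rewrite -subr_eq0; apply/eqP/val_inj.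
  apply: other_summands_meet; first exact: valP.
  by rewrite -pi_eq0; apply/eqP.
have [s sK] := linear_left_inverse pI.
exists (e \o (s \o qproj other_summands)); split=> [d|k kj x xk].
  exact: congr1 (sK d).
have /eqP qx : qproj other_summands x == 0 by rewrite pi_eq0; exact: other_summands_in xk.
by rewrite /= qx !linear0.
Qed.
End OtherSummands.

(** The summands other than D_j are subcoalgebras on which [f] vanishes, so
    translation by [f] kills them. *)
Lemma colift_summand (K : fieldType) (C : coalgebra K) (I : choiceType)
    (D : I -> submodClosed C) (j : I) (f : {scalar C}) :
  coradical_decomposition D -> (forall k, k != j -> forall c, c \in D k -> f c = 0) ->
  forall c, c \in coradical C ->
  exists2 d, d \in D j & @colift K C (regular C) f c = @colift K C (regular C) f d.
Proof.
move=> [simD [D0 _]] fk c /D0[s [d [dD ->]]].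
have Tk k : k != j -> @colift K C (regular C) f (d k) = 0.
  move=> kj; have [subD _ _] := simD k.
  exact: (colift_vanish subD (fk k kj) (dD k)).
move: (@colift K C (regular C) f : {linear C -> C}) Tk => t tk.
elim: s => [|k s [x xj IH]].
  by exists 0; [exact: (rpred0 (D j))|rewrite big_nil].
rewrite big_cons linearD IH; have [->|kj] := eqVneq k j.
  by exists (d j + x); [exact: rpredD|rewrite linearD].
by exists x; rewrite // tk // add0r.
Qed.

Theorem theorem2p3 (K : fieldType) (C : coalgebra K) (I : choiceType)
    (D : I -> submodClosed C) (S : I -> comodule C)
    (e : forall i : I, {scalar sub (D i)}) :
  coradical_decomposition D ->
  complete_simples D S ->
  (forall i : I, primitive_idempotent (e i)) ->
  forall (i j : I) (R : injective_resolution (S j)),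
    same_dim (sub (gabriel_space (e i) (e j))) (Ext1 (S i) R).
Proof.
move=> decD [simS _ _ powS] prim i j R.
have [simD dsum] := decD.
have subD k : subcoalgebra (D k) by have [] := simD k.
have DC0 k : {subset D k <= coradical C}.
  by move=> c Dc; apply: span_in; exists (D k).
have [fi [fiE _]] := form_on_summand dsum (e i).
have [fj [fjE fj0]] := form_on_summand dsum (e j).
have primi := primitive_extend (subD i) fiE (prim i).
have primj := primitive_extend (subD j) fjE (prim j).
have [ni /power_coordinates_exist[Xi]] := powS i.
have [nj /power_coordinates_exist[Xj]] := powS j.
have [emb [embC embI embD Temb Demb]] := primitive_embedding Xj (subD j) (simS j) primj.
have TC0 c : c \in coradical C -> exists x, @colift K C (regular C) fj c = emb x.
  by move=> /(colift_summand decD fj0)[d Dd ->]; exact: Demb.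
have [u u0 fiu] := fixed_vector_exists Xi (subD i) primi.
have coactC0 := coact_in_coradical (subD i) (DC0 i) Xi primi.
have [F bijF] := fixed_hom_Ext1 R embC embI (fun x => DC0 j _ (embD x)) Temb TC0 coactC0.
have TDj c : c \in coradical C -> @colift K C (regular C) fj c \in D j.
  by move=> /TC0[x ->].
have [idemj _ _] := primj.
exact: same_dim_bij2 (eval_fixed_bij fiE fjE (subD i) (DC0 i) Xi (simS i) primi idemj
  TDj u0 fiu) bijF.
Qed.
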